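(* The vector subspace $\mathsf{PT}$ of $\mathsf{FQSym}_{\{\mathsf N,\mathsf D,\mathsf U,\mathsf X\}}$ spanned by the elements $\mathbb P_T=\sum_{\tau\in\mathcal L(T)}\mathbb F_\tau$, for all permutrees $T$, is a Hopf subalgebra of $\mathsf{FQSym}_{\{\mathsf N,\mathsf D,\mathsf U,\mathsf X\}}$.
   Context: Permutrees. A decoration of size $n$ is a word $\delta=\delta_1\cdots\delta_n$ in the symbols $\mathsf N$ (none), $\mathsf D$ (down), $\mathsf U$ (up), $\mathsf X$ (both). A permutree is a directed tree $T$ with $n$ vertices labeled bijectively by $[n]=\{1,\dots,n\}$ (vertices are identified with labels; $n=0$ allowed) in which each vertex has one or two parents (outgoing neighbors) and one or two children (incoming neighbors); a parent or child may be an unlabeled leaf (dangling edge), so ancestor and descendant subtrees may be empty. The ancestor (resp. descendant) subtree of $i$ through a given parent (resp. child) is the whole connected component, reached through it, of the tree with $i$ removed. If $i$ has two parents (resp. children), they are distinguished as left and right, and all labels in the left ancestor (resp. descendant) subtree of $i$ are smaller than $i$ while all labels in the right one are larger than $i$. The decoration of $T$ is given by $\delta(T)_i=\mathsf N,\mathsf D,\mathsf U,\mathsf X$ according to whether $i$ has (one parent, one child), (one parent, two children), (two parents, one child), (two parents, two children). Decorated permutations. A decorated permutation is a permutation $\tau=\tau_1\cdots\tau_n$ of $[n]$, $n\ge0$, each of whose letters carries a decoration in $\{\mathsf N,\mathsf D,\mathsf U,\mathsf X\}$. $\mathcal L(T)$ is the set of linear extensions of $T$: permutations $\tau$ of $[n]$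 in which $i$ appears before $j$ for each edge $i\to j$ of $T$, each value $i$ being decorated by $\delta(T)_i$. Let $\mathfrak S^{(n,n')}$ be the set of $\pi\in\mathfrak S_{n+n'}$ with $\pi_1<\dots<\pi_n$ and $\pi_{n+1}<\dots<\pi_{n+n'}$. For $\tau\in\mathfrak S_n,\tau'\in\mathfrak S_{n'}$ let $\tau\bar\tau'=[\tau_1,\dots,\tau_n,\tau'_1+n,\dots,\tau'_{n'}+n]$. The shifted shuffle is $\tau\,\bar\sqcup\,\tau'=\{(\tau\bar\tau')\circ\pi^{-1}:\pi\in\mathfrak S^{(n,n')}\}$ and the convolution is $\tau\star\tau'=\{\pi\circ(\tau\bar\tau'):\pi\in\mathfrak S^{(n,n')}\}$. For decorated permutations, decorations travel with their values in the shifted shuffle, and stay at their positions in the convolution. $\mathsf{FQSym}_{\{\mathsf N,\mathsf D,\mathsf U,\mathsf X\}}$ is the Hopf algebra (over a fixed field) with basis $(\mathbb F_\tau)$ indexed by decorated permutations, with product $\mathbb F_\tau\cdot\mathbb F_{\tau'}=\sum_{\sigma\in\tau\bar\sqcup\tau'}\mathbb F_\sigma$ and coproduct $\triangle\mathbb F_\sigma=\sum_{(\tau,\tau'):\,\sigma\in\tau\star\tau'}\mathbb F_\tau\otimes\mathbb F_{\tau'}$. *)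

(* Defs.v *)
From HB Require Import structures.
From mathcomp Require Import all_boot all_order all_algebra all_fingroup.
From mathcomp.finmap Require Import finmap.
From mathcomp Require Import monalg.

Set Implicit Arguments.
Unset Strict Implicit.
Unset Printing Implicit Defensive.

Import GRing.Theory.
Local Open Scope ring_scope.

(* The labels 1, ..., n are represented by 'I_n = {0, ..., n-1}: every label  *)
(* and every position is lowered by one.                                      *)

Inductive deco := decoN | decoD | decoU | decoX.

Definition deco_code (d : deco) : bool * bool :=
  match d with
  | decoN => (false, false) | decoD => (false, true)
  | decoU => (true, false)  | decoX => (true, true)
  end.

Definition deco_decode (c : bool * bool) : deco :=
  match c with
  | (false, false) => decoN | (false, true) => decoD
  | (true, false) => decoU  | (true, true) => decoX
  end.

Lemma deco_codeK : cancel deco_code deco_decode.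
Proof. by case. Qed.

HB.instance Definition _ := Finite.copy deco (can_type deco_codeK).

(** * Permutrees *)

(* The parents (or the children) of a vertex: a single one, or a left one     *)
(* followed by a right one. [None] is an unlabeled leaf.                      *)
Inductive slots (n : nat) :=
  | One of option 'I_n
  | Two of option 'I_n & option 'I_n.

Definition linked n (s : slots n) (j : 'I_n) : bool :=
  match s with
  | One a => a == Some j
  | Two l r => (l == Some j) || (r == Some j)
  end.

Definition is_tree n (g : rel 'I_n) : Prop :=
  [/\ forall i, ~~ g i i,
      forall i j, connect g i j
    & forall c : seq 'I_n, ucycle g c -> (size c <= 2)%N].

(* The connected component reached from a vertex i through one of its slots   *)
(* after removal of i.                                                        *)
Definition branch n (g : rel 'I_n) (i : 'I_n) (a : option 'I_n) : pred 'I_n :=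
  fun j => if a is Some p
           then connect [rel x y | [&& x != i, y != i & g x y]] p j
           else false.

Definition left_right n (g : rel 'I_n) (i : 'I_n) (s : slots n) : Prop :=
  match s with
  | One _ => True
  | Two l r => (forall j, branch g i l j -> (j < i)%N) /\
               (forall j, branch g i r j -> (i < j)%N)
  end.

Section Adjacency.
Variables (n : nat) (par : 'I_n -> slots n).

(* i -> j : edges point from children to parents. *)
Definition edge : rel 'I_n := fun i j => linked (par i) j.

Definition adjacent : rel 'I_n := fun i j => edge i j || edge j i.

End Adjacency.

Record permutree (n : nat) := Permutree {
  parents : 'I_n -> slots n;
  children : 'I_n -> slots n;
  permutree_linked : forall i j, linked (parents i) j = linked (children j) i;
  permutree_simple : forall i j, ~~ (edge parents i j && edge parents j i);
  permutree_tree : is_tree (adjacent parents);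
  permutree_ancestors : forall i, left_right (adjacent parents) i (parents i);
  permutree_descendants : forall i, left_right (adjacent parents) i (children i)
}.

Definition decoration n (T : permutree n) (i : 'I_n) : deco :=
  match parents T i, children T i with
  | One _,   One _   => decoN
  | One _,   Two _ _ => decoD
  | Two _ _, One _   => decoU
  | Two _ _, Two _ _ => decoX
  end.

(** * Decorated permutations *)

(* The letter of t : dperm n at position p is t.1 p, with decoration t.2 p:   *)
(* decorations are indexed by positions.                                      *)
Definition dperm (n : nat) : Type := ('S_n * {ffun 'I_n -> deco})%type.

HB.instance Definition _ n :=
  Finite.copy (dperm n) ('S_n * {ffun 'I_n -> deco})%type.

Definition dword : Type := {n : nat & dperm n}.

HB.instance Definition _ := Choice.copy dword {n : nat & dperm n}.

Definition DWord n (t : dperm n) : dword := Tagged dperm t.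

Definition linear_extensions n (T : permutree n) : {set dperm n} :=
  [set t : dperm n |
     [forall i, forall j,
        edge (parents T) i j ==> ((t.1^-1)%g i < (t.1^-1)%g j)%N]
     && [forall p, t.2 p == decoration T (t.1 p)]].

Section ShuffleConvolution.
Variables n n' : nat.

Definition grassmannian : {set 'S_(n + n')} :=
  [set w : 'S_(n + n') |
     [forall i : 'I_n, forall j : 'I_n,
        (i < j)%N ==> (w (lshift n' i) < w (lshift n' j))%N]
     && [forall i : 'I_n', forall j : 'I_n',
        (i < j)%N ==> (w (rshift n i) < w (rshift n j))%N]].

Definition shift_concat_fun (s : 'S_n) (s' : 'S_n') (p : 'I_(n + n')) :
    'I_(n + n') :=
  match split p with
  | inl i => lshift n' (s i)
  | inr i => rshift n (s' i)
  end.

Lemma shift_concat_inj s s' : injective (shift_concat_fun s s').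
Proof.
move=> p q; rewrite /shift_concat_fun.
case: (split_ordP p) => i ->; case: (split_ordP q) => j ->.
- by move/lshift_inj/perm_inj->.
- by move/eqP; rewrite eq_lrshift.
- by move/eqP; rewrite eq_rlshift.
- by move/rshift_inj/perm_inj->.
Qed.

Definition shift_concat (s : 'S_n) (s' : 'S_n') : 'S_(n + n') :=
  perm (@shift_concat_inj s s').

Definition deco_concat (d : {ffun 'I_n -> deco}) (d' : {ffun 'I_n' -> deco}) :
    {ffun 'I_(n + n') -> deco} :=
  [ffun p => match split p with inl i => d i | inr i => d' i end].

(* In MathComp (u * v)%g maps x to v (u x), so that (w^-1 * u)%g is the       *)
(* composition of u after w^-1, and (u * w)%g that of w after u.              *)
Definition shifted_shuffle (t : dperm n) (t' : dperm n') :
    {set dperm (n + n')} :=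
  [set ((w^-1 * shift_concat t.1 t'.1)%g,
        [ffun p => deco_concat t.2 t'.2 ((w^-1)%g p)]) | w in grassmannian].

Definition convolution (t : dperm n) (t' : dperm n') : {set dperm (n + n')} :=
  [set ((shift_concat t.1 t'.1 * w)%g, deco_concat t.2 t'.2)
     | w in grassmannian].

End ShuffleConvolution.

(** * Free modules *)

Section FreeModules.
Variable K : fieldType.

Definition lin_ext (I : choiceType) (W : lmodType K) (f : I -> W)
    (x : {malg K[I]}) : W :=
  \sum_(k <- msupp x) x@_k *: f k.

Lemma lin_extEw (I : choiceType) (W : lmodType K) (f : I -> W)
    (A : {fset I}) (x : {malg K[I]}) :
  (msupp x `<=` A)%fset -> lin_ext f x = \sum_(k <- A) x@_k *: f k.
Proof.
move=> le; rewrite [LHS](big_fset_incl _ le) => //= k _ /mcoeff_outdom ->.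
by rewrite scale0r.
Qed.

Lemma lin_ext_is_linear (I : choiceType) (W : lmodType K) (f : I -> W) :
  linear (lin_ext f).
Proof.
move=> c x y.
pose A := (msupp x `|` msupp y `|` msupp (c *: x + y))%fset.
have sx : (msupp x `<=` A)%fset by rewrite /A -fsetUA fsubsetUl.
have sy : (msupp y `<=` A)%fset by rewrite /A fsetUAC fsubsetUr.
have sxy : (msupp (c *: x + y) `<=` A)%fset by rewrite /A fsubsetUr.
rewrite (lin_extEw f sx) (lin_extEw f sy) (lin_extEw f sxy).
rewrite scaler_sumr -big_split /=; apply: eq_bigr => k _.
by rewrite mcoeffD mcoeffZ scalerDl scalerA.
Qed.

HB.instance Definition _ (I : choiceType) (W : lmodType K) (f : I -> W) :=
  GRing.isLinear.Build K {malg K[I]} W *:%R (lin_ext f)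
    (lin_ext_is_linear f).

(* The tensor product of the free modules on I and J is the free module on    *)
(* I * J, with << i >> (x) << j >> = << (i, j) >>.                            *)
Definition tensor (I J : choiceType) (x : {malg K[I]}) (y : {malg K[J]}) :
    {malg K[(I * J)%type]} :=
  lin_ext (fun i => lin_ext (fun j => << (i, j) >> : {malg K[(I * J)%type]}) y) x.

Definition tensor_map (I J I' J' : choiceType)
    (f : {malg K[I]} -> {malg K[I']}) (g : {malg K[J]} -> {malg K[J']}) :
    {malg K[(I * J)%type]} -> {malg K[(I' * J')%type]} :=
  lin_ext (fun ij : I * J => tensor (f << ij.1 >>) (g << ij.2 >>)).

Definition span (V : lmodType K) (P : V -> Prop) (v : V) : Prop :=
  exists s : seq (K * V),
    (forall p, p \in s -> P p.2) /\ v = \sum_(p <- s) p.1 *: p.2.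

Definition tensor_square (I : choiceType) (P : {malg K[I]} -> Prop) :
    {malg K[(I * I)%type]} -> Prop :=
  span (fun z => exists x y, [/\ P x, P y & z = tensor x y]).

End FreeModules.

(** * The Hopf algebra FQSym on decorated permutations *)

Section FQSym.
Variable K : fieldType.

Definition FQSym : lmodType K := {malg K[dword]}.
Definition FQSym2 : lmodType K := {malg K[(dword * dword)%type]}.

Definition F_ (s : dword) : FQSym := (<< s >> : {malg K[dword]}).

Definition fq_mulT : FQSym2 -> FQSym :=
  lin_ext (fun ts : dword * dword =>
    \sum_(s in shifted_shuffle (tagged ts.1) (tagged ts.2)) F_ (DWord s)).

Definition fq_mul (x y : FQSym) : FQSym := fq_mulT (tensor x y).

(* Only pairs with sizes adding up to the size of s can have s in their       *)
(* convolution; the two sides of the equation live in dperm (k + (m - k)) and *)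
(* dperm m, hence the comparison in dword.                                    *)
Definition fq_comul : FQSym -> FQSym2 :=
  lin_ext (fun s : dword =>
    \sum_(k < (tag s).+1) \sum_(t : dperm k)
      \sum_(t' : dperm (tag s - k) |
              [exists r in convolution t t', DWord r == s])
        tensor (F_ (DWord t)) (F_ (DWord t'))).

Definition fq_one : FQSym := F_ (DWord ((1%g, [ffun=> decoN]) : dperm 0)).

Definition fq_counit : FQSym -> K :=
  lin_ext (fun s : dword => if tag s == 0%N then 1 else 0 : K^o).

(* The antipode is the inverse of the identity for the convolution product of *)
(* linear endomorphisms, hence unique.                                        *)
Definition is_antipode (S : {linear FQSym -> FQSym}) : Prop :=
  forall x : FQSym,
    fq_mulT (tensor_map S id (fq_comul x)) = fq_counit x *: fq_one /\
    fq_mulT (tensor_map id S (fq_comul x)) = fq_counit x *: fq_one.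

Record hopf_subalgebra (W : FQSym -> Prop) : Prop := HopfSubalgebra {
  hopf_sub0 : W 0;
  hopf_subP : forall (c : K) x y, W x -> W y -> W (c *: x + y);
  hopf_sub_one : W fq_one;
  hopf_sub_mul : forall x y, W x -> W y -> W (fq_mul x y);
  hopf_sub_comul : forall x, W x -> tensor_square W (fq_comul x);
  hopf_sub_antipode :
    exists S : {linear FQSym -> FQSym},
      is_antipode S /\ forall x, W x -> W (S x)
}.

Definition P_ n (T : permutree n) : FQSym :=
  \sum_(t in linear_extensions T) F_ (DWord t).

Definition PT : FQSym -> Prop :=
  span (fun x => exists (n : nat) (T : permutree n), x = P_ T).

End FQSym.

(* Main.v *)
From HB Require Import structures.
Require Import Defs.
From mathcomp Require Import all_boot all_algebra all_fingroup.
From mathcomp.finmap Require Import finmap.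
From mathcomp Require Import monalg zify.

(** The sets of linear extensions of permutrees have a description that does
    not mention trees. Call step the exchange of two neighbouring letters x and
    y of a decorated permutation that is licensed by a witness: a letter b with
    value strictly between x and y which either is marked with two children and
    is placed after them, or is marked with two parents and is placed before
    them. The sets [linear_extensions T] are exactly the classes of the
    equivalence generated by steps:
    - they are stable under steps ([step_linext]), because the witness b keeps x
      and y from being joined by an edge: a tree path from b through both ends of
      such an edge would force b to be placed before one of them, or after one of
      them when b has two parents ([edge_around_before]);
    - two linear extensions of T are joined by steps ([linext_connect]), by
      sorting one into the other: when neighbours x and y have to be exchanged,
      the tree path from x to y is not monotone, and its first turn is a witness
      ([before_or_turn]);
    - every decorated permutation s extends some permutree ([exists_permutree]).
      Draw the letter v at abscissa v and at the height of its place in s, with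
      a vertical wall above it when it has two parents and below it when it has
      two children; the walls cut each horizontal line into strands, and the
      edges join the letters that follow each other along a strand.

    Hence [PT] consists of the elements whose coefficients are constant on the
    classes, and its tensor square of those whose coefficients are so in both
    arguments ([PT_invariant], [invariant_PT], [bi_invariant_decomposition]).
    Closure under the operations becomes a statement about coefficients. The
    coefficient of s in x * y is the sum over all k of the coefficient of the
    pattern of the values below k in x times that of the pattern of the other
    values in y ([mcoeff_mul]). A step of s induces a step on one of these
    patterns or leaves both alone, since a witness lies between the exchanged
    values ([block_step]). The coefficient of (p, q) in the coproduct of x is
    the sum of the coefficients of x on the convolution of p and q
    ([mcoeff_comul]), and a step of p or of q lifts to each permutation of that
    convolution ([glue_step_l], [glue_step_r]).

    FQSym is graded and connected, so the antipode equations determine a left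
    and a right antipode by recursion on the size, and these agree by
    associativity and coassociativity ([left_right_antipode]). The left
    recursion computes the antipode in size n from the parts of the coproduct
    whose first factor has size less than n; these parts lie in the tensor
    square of [PT], so [PT] is preserved by induction on n
    ([PT_antipode_homogeneous]). *)

Set Implicit Arguments.
Unset Strict Implicit.
Unset Printing Implicit Defensive.

(** * Paths in a tree with left and right slots *)

Definition is_down (d : deco) : bool := (deco_code d).2.
Definition is_up (d : deco) : bool := (deco_code d).1.

Definition between (a b c : nat) : bool := (a < b < c) || (c < b < a).

Definition is_two n (s : slots n) : bool := if s is Two _ _ then true else false.

(** A path that avoids v stays in one branch at v; this is how all the side
    conditions on branches are used. *)
Lemma branch_path n (g : rel 'I_n) (v x y : 'I_n) (p : seq 'I_n) :
  path g x p -> v \notin x :: p -> y \in x :: p -> branch g v (Some x) y.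
Proof.
move=> gp vp yp; apply: (path_connect _ yp).
elim: p x gp vp {yp} => //= z p IH x /andP[gxz gp].
rewrite !inE !negb_or => /and3P[vx vz vp].
rewrite eq_sym vx eq_sym vz gxz /=; apply: IH => //.
by rewrite !inE negb_or vz.
Qed.

(** In the two walks along a path below, the vertices already passed are kept in
    reverse order; a move forward transfers one vertex to them. *)
Lemma uniq_shift (T : eqType) (v y : T) (r q : seq T) :
  uniq (v :: r ++ y :: q) = uniq (y :: (v :: r) ++ q).
Proof. by apply: perm_uniq; rewrite -!cat_cons -cat1s -(cat1s y) perm_catCA. Qed.

(** The map [sl] is either the children or the parents of a permutree, and
    [before] is the order of the places of a linear extension, or its reverse.
    The two choices give the statements on letters with two children and those
    on letters with two parents. *)
Section Turns.

Variables (n : nat) (g : rel 'I_n) (sl : 'I_n -> slots n).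
Hypothesis sl_sides : forall v, left_right g v (sl v).
Variable before : rel 'I_n.
Hypothesis before_trans : transitive before.
Hypothesis gsym : symmetric g.
Hypothesis sl_before : forall v x, linked (sl v) x -> before x v.
Hypothesis g_linked :
  forall x y, g x y -> linked (sl y) x || linked (sl x) y.

Lemma linked_same_side v x y z :
  is_two (sl v) -> linked (sl v) x -> branch g v (Some x) y ->
  branch g v (Some x) z -> ~~ between y v z.
Proof.
have := sl_sides v; rewrite /between.
case: (sl v) => //= l r [Hl Hr] _ /orP[] /eqP E by_ bz; subst.
- by have := Hl _ by_; have := Hl _ bz; lia.
- by have := Hr _ by_; have := Hr _ bz; lia.
Qed.

(** At a vertex where a path turns from up to down, the two neighbours on the
    path are different children; so there are two slots, and the two parts of
    the path lie on the two sides of that vertex. *)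
Lemma linked_opposite v x y x' y' :
  linked (sl v) x -> linked (sl v) y -> x != y ->
  branch g v (Some x) x' -> branch g v (Some y) y' ->
  is_two (sl v) && between x' v y'.
Proof.
have := sl_sides v; rewrite /between.
case: (sl v) => /= [a _ /eqP-> /eqP[->]|l r [Hl Hr]]; first by rewrite eqxx.
case/orP=> /eqP Ex /orP[] /eqP Ey xy bx by_; subst.
- by case: Ey xy => ->; rewrite eqxx.
- by have := Hl _ bx; have := Hr _ by_; lia.
- by have := Hr _ bx; have := Hl _ by_; lia.
- by case: Ey xy => ->; rewrite eqxx.
Qed.

(** While the path climbs, b is before the current vertex v. If it started to
    descend at v, then v would separate b from all that follows; but lo and hi
    still have to come and they enclose b. *)
Lemma enclosed_before_from b lo hi x v r q :
  path g v (x :: r) -> path g v q -> uniq (v :: (x :: r) ++ q) -> b \in x :: r ->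
  linked (sl v) x -> before b v ->
  lo \in v :: q -> hi \in v :: q -> lo < b < hi -> before b lo || before b hi.
Proof.
elim: q v x r => [|y q IH] v x r.
  by move=> _ _ _ _ _ bv; rewrite !inE => /eqP-> /eqP->; lia.
move=> pr pq uq br lx bv; rewrite !(in_cons v).
case/predU1P=> [->|lo_q]; first by rewrite bv.
case/predU1P=> [->|hi_q]; first by rewrite bv orbT.
move=> lobhi.
have /= /andP[gvy pq'] := pq.
have [ly|nly] := boolP (linked (sl y) v).
  apply: (IH y v (x :: r)) => //.
  - by rewrite /= gsym gvy.
  - by rewrite -uniq_shift.
  - by rewrite inE br orbT.
  - exact: before_trans bv (sl_before ly).
have lyv : linked (sl v) y by have := g_linked gvy; rewrite (negPf nly).
have [vx [vq xy]] : v \notin x :: r /\ v \notin y :: q /\ x != y.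
  move: uq; rewrite cons_uniq mem_cat negb_or cat_uniq => /andP[/andP[-> ->]].
  case/and3P=> _ /hasPn/(_ y); rewrite mem_head => /(_ isT) /=.
  by rewrite in_cons negb_or eq_sym => /andP[-> _] _.
have opp z : z \in y :: q -> between b v z.
  move=> zq; have := linked_opposite lx lyv xy.
  move/(_ b z); case/(_ _ _)/andP => //.
  - by apply: (branch_path _ vx) => //; case/andP: pr.
  - exact: (branch_path pq').
by move: (opp _ lo_q) (opp _ hi_q) lobhi; rewrite /between; clear; lia.
Qed.

(** The first edge of the path leaves b upwards, since lo and hi lie on different
    sides of b and thus in no branch through a child of b. *)
Lemma enclosed_before b lo hi q :
  path g b q -> uniq (b :: q) -> is_two (sl b) ->
  lo \in q -> hi \in q -> lo < b < hi -> before b lo || before b hi.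
Proof.
case: q => [|y q] // pq uq tb lo_q hi_q lobhi.
have /= /andP[gby pq'] := pq.
have [ly|nly] := boolP (linked (sl y) b).
  apply: (@enclosed_before_from b lo hi b y [::] q) => //=.
  - by rewrite gsym gby.
  - by have /= <- := uniq_shift b y [::] q.
  - by rewrite mem_head.
  - exact: sl_before.
have lyb : linked (sl b) y by have := g_linked gby; rewrite (negPf nly).
have bq : b \notin y :: q by case/andP: uq.
have := linked_same_side tb lyb (branch_path pq' bq lo_q)
  (branch_path pq' bq hi_q).
by rewrite /between lobhi.
Qed.

(** If the path does not climb up to y, then [linked_opposite] applies to the
    vertex at which it first descends. *)
Lemma before_or_turn_from x y w v r q :
  path g v (w :: r) -> path g v q -> uniq (v :: (w :: r) ++ q) -> x \in w :: r ->
  linked (sl v) w -> before x v -> y \in v :: q ->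
  before x y \/ exists b, [/\ is_two (sl b), between x b y & before x b].
Proof.
elim: q v w r => [|z q IH] v w r pr pq uq xr lw xv.
  by rewrite inE => /eqP->; left.
rewrite (in_cons v); case/predU1P=> [->|yq]; first by left.
have /= /andP[gvz pq'] := pq.
have [lz|nlz] := boolP (linked (sl z) v).
  apply: (IH z v (w :: r)) => //.
  - by rewrite /= gsym gvz.
  - by rewrite -uniq_shift.
  - by rewrite inE xr orbT.
  - exact: before_trans xv (sl_before lz).
have lzv : linked (sl v) z by have := g_linked gvz; rewrite (negPf nlz).
have [vx [vq wz]] : v \notin w :: r /\ v \notin z :: q /\ w != z.
  move: uq; rewrite cons_uniq mem_cat negb_or cat_uniq => /andP[/andP[-> ->]].
  case/and3P=> _ /hasPn/(_ z); rewrite mem_head => /(_ isT) /=.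
  by rewrite in_cons negb_or eq_sym => /andP[-> _] _.
right; exists v.
have /andP[-> ->] // : is_two (sl v) && between x v y.
apply: (linked_opposite lw lzv wz).
- by apply: (branch_path _ vx) => //; case/andP: pr.
- exact: (branch_path pq').
Qed.

Lemma before_or_turn x y z q :
  path g x (z :: q) -> uniq (x :: z :: q) -> linked (sl z) x -> y \in z :: q ->
  before x y \/ exists b, [/\ is_two (sl b), between x b y & before x b].
Proof.
move=> /= /andP[gxz pq] uq lz yq.
apply: (@before_or_turn_from x y x z [::] q) => //=.
- by rewrite gsym gxz.
- by have /= <- := uniq_shift x z [::] q.
- by rewrite mem_head.
- exact: sl_before.
Qed.

Hypothesis gconn : forall x y, connect g x y.

(** A path from b to an end of the edge either contains the other end or can be
    extended to it without a repetition, so [enclosed_before] applies. *)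
Lemma edge_around_before b x y :
  g x y -> is_two (sl b) -> between x b y -> before b x || before b y.
Proof.
move=> gxy tb bt.
have [q [pq uq xq yq]] :
    exists q, [/\ path g b q, uniq (b :: q), x \in q & y \in q].
  have bx : b != x by apply: contraTneq bt => ->; rewrite /between; clear; lia.
  have by' : b != y by apply: contraTneq bt => ->; rewrite /between; clear; lia.
  have /connectP[p0 /shortenP[p pp up _] xE] := gconn b x.
  have xp : x \in p by have := mem_last b p; rewrite -xE inE eq_sym (negPf bx).
  have [yp|nyp] := boolP (y \in p); first by exists p.
  exists (rcons p y); split.
  - by rewrite rcons_path pp -xE.
  - rewrite -rcons_cons rcons_uniq up andbT inE negb_or nyp andbT.
    by rewrite eq_sym.
  - by rewrite mem_rcons inE xp orbT.
  - by rewrite mem_rcons mem_head.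
case/orP: bt => bt; first exact: (enclosed_before pq uq tb xq yq bt).
by rewrite orbC; apply: (enclosed_before pq uq tb yq xq bt).
Qed.

End Turns.

(** * Steps and linear extensions *)

Section Words.
Variable n : nat.
Implicit Types s t : dperm n.

Definition place s (v : 'I_n) : 'I_n := (s.1^-1)%g v.
Definition deco_of s (v : 'I_n) : deco := s.2 (place s v).

Lemma place_inj s : injective (place s).
Proof. exact: perm_inj. Qed.

Lemma placeK s v : s.1 (place s v) = v.
Proof. exact: permKV. Qed.

Lemma place1 s p : place s (s.1 p) = p.
Proof. exact: permK. Qed.

Definition mk_dperm (u : 'S_n) (d : 'I_n -> deco) : dperm n :=
  (u, [ffun p => d (u p)]).

Lemma deco_of_mk u d v : deco_of (mk_dperm u d) v = d v.
Proof. by rewrite /deco_of ffunE; congr d; apply: (placeK (mk_dperm u d)). Qed.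

Lemma dperm_eqP s t : s.1 = t.1 -> deco_of s =1 deco_of t -> s = t.
Proof.
case: s t => [u d] [u' d'] /= E H; subst u'; congr pair; apply/ffunP => p.
by have := H (u p); rewrite /deco_of !(place1 (u, _)).
Qed.

Definition swap s (x y : 'I_n) : dperm n :=
  mk_dperm (s.1 * tperm x y)%g (deco_of s).

Lemma place_swap s x y v : place (swap s x y) v = place s (tperm x y v).
Proof. by rewrite /place /= invMg permM tpermV. Qed.

Lemma place_swap_lt s (x y u v : 'I_n) : place s y = (place s x).+1 :> nat ->
  (u, v) != (x, y) -> (u, v) != (y, x) ->
  (place (swap s x y) u < place (swap s x y) v) = (place s u < place s v).
Proof.
move=> pxy; rewrite !place_swap => n1 n2.
have ne a b : a <> b -> place s a <> place s b :> nat.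
  by move=> H /val_inj/place_inj.
case: (tpermP x y u) n1 n2 => [->|->|/ne ux /ne uy];
  case: (tpermP x y v) => [->|->|/ne vx /ne vy]; rewrite ?eqxx // => _ _.
- by rewrite !ltnn.
- by move: vx vy pxy; clear; lia.
- by rewrite !ltnn.
- by move: vx vy pxy; clear; lia.
- by move: ux uy pxy; clear; lia.
- by move: ux uy pxy; clear; lia.
Qed.

Lemma deco_of_swap s x y v : deco_of (swap s x y) v = deco_of s v.
Proof. exact: deco_of_mk. Qed.

Definition wall s (x y b : 'I_n) : bool :=
  (is_down (deco_of s b) && (place s y < place s b))
  || (is_up (deco_of s b) && (place s b < place s x)).

(** These are the elementary moves of the permutree congruence, in either
    direction: the condition on the witness b does not depend on the order of the
    neighbours x and y, so steps are reversible. *)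
Definition step : rel (dperm n) := fun s t =>
  [exists x : 'I_n, exists y : 'I_n, exists b : 'I_n,
     [&& place s y == (place s x).+1 :> nat, between x b y, wall s x y b
       & t == swap s x y]].

Lemma stepP s t :
  reflect (exists x y b : 'I_n, [/\ place s y = (place s x).+1 :> nat, between x b y,
             wall s x y b & t = swap s x y]) (step s t).
Proof.
apply: (iffP existsP) => [[x /existsP[y /existsP[b]]]|[x [y [b [? ? ? ?]]]]].
  by case/and4P=> /eqP ? ? ? /eqP ?; exists x, y, b.
exists x; apply/existsP; exists y; apply/existsP; exists b.
by apply/and4P; split=> //; apply/eqP.
Qed.

Lemma betweenC (x b y : 'I_n) : between x b y = between y b x.
Proof. by rewrite /between orbC. Qed.

Lemma between_neq (x b y : 'I_n) : between x b y -> (b != x) && (b != y).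
Proof. by rewrite /between -!val_eqE /=; lia. Qed.

Lemma step_sym : symmetric step.
Proof.
suff H s t : step s t -> step t s by move=> s t; apply/idP/idP; apply: H.
case/stepP=> x [y [b [pxy bt w ->]]]; apply/stepP; exists y, x, b.
rewrite betweenC !place_swap tpermL tpermR; split=> //.
  have /andP[bx by_] := between_neq bt.
  move: w; rewrite /wall deco_of_swap !place_swap tpermL tpermR.
  by rewrite tpermD 1?eq_sym // pxy.
apply: dperm_eqP => [|v]; last by rewrite !deco_of_swap.
by rewrite /= tpermC -mulgA tperm2 mulg1.
Qed.

Lemma connect_step_sym : connect_sym step.
Proof. by apply: sym_connect_sym; apply: step_sym. Qed.

End Words.

Section Extensions.
Variables (n : nat) (T : permutree n).
Implicit Types s t : dperm n.

Local Notation g := (adjacent (parents T)).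

Lemma linextP s :
  reflect ((forall i j, edge (parents T) i j -> place s i < place s j)
           /\ forall v, deco_of s v = decoration T v)
          (s \in linear_extensions T).
Proof.
rewrite inE; apply: (iffP andP) => -[H1 H2]; split.
- by move=> i j eij; move/forallP/(_ i)/forallP/(_ j)/implyP: H1; apply.
- by move=> v; move/forallP/(_ (place s v))/eqP: H2; rewrite placeK.
- by apply/forallP=> i; apply/forallP=> j; apply/implyP; apply: H1.
- by apply/forallP=> p; have := H2 (s.1 p); rewrite /deco_of place1 => ->.
Qed.

Lemma is_down_decoration v : is_down (decoration T v) = is_two (children T v).
Proof. by rewrite /decoration; case: (parents T v); case: (children T v). Qed.

Lemma is_up_decoration v : is_up (decoration T v) = is_two (parents T v).
Proof. by rewrite /decoration; case: (parents T v); case: (children T v). Qed.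

Lemma adjacent_sym : symmetric g.
Proof. by move=> x y; rewrite /adjacent orbC. Qed.

Lemma adjacent_connect x y : connect g x y.
Proof. by case: (permutree_tree T). Qed.

Lemma adjacent_children u v :
  g u v -> linked (children T v) u || linked (children T u) v.
Proof. by move=> guv; rewrite -!permutree_linked. Qed.

Lemma adjacent_parents u v :
  g u v -> linked (parents T v) u || linked (parents T u) v.
Proof. by rewrite orbC. Qed.

Section OneExtension.
Variable s : dperm n.
Hypothesis sT : s \in linear_extensions T.

Let lin := (linextP s sT).1.

Lemma down_blocked x y b :
  g x y -> is_down (deco_of s b) -> between x b y ->
  place s b < place s x \/ place s b < place s y.
Proof.
move=> gxy; rewrite (linextP s sT).2 is_down_decoration => tb bt; apply/orP.
apply: (@edge_around_before _ g (children T) (permutree_descendants T)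
          (fun u v => place s u < place s v)) => //.
- by move=> ? ? ?; apply: ltn_trans.
- exact: adjacent_sym.
- by move=> v u; rewrite -permutree_linked; apply: lin.
- exact: adjacent_children.
- exact: adjacent_connect.
Qed.

Lemma up_blocked x y b :
  g x y -> is_up (deco_of s b) -> between x b y ->
  place s x < place s b \/ place s y < place s b.
Proof.
move=> gxy; rewrite (linextP s sT).2 is_up_decoration => tb bt; apply/orP.
apply: (@edge_around_before _ g (parents T) (permutree_ancestors T)
          (fun u v => place s v < place s u)) => //.
- by move=> y' x' z' /= A B; apply: ltn_trans B A.
- exact: adjacent_sym.
- exact: adjacent_parents.
- exact: adjacent_connect.
Qed.

End OneExtension.

(** Only the order of x and y changes, so what has to be excluded is an edge
    from x to y, and the witness excludes it. *)
Lemma step_linext s t :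
  step s t -> s \in linear_extensions T -> t \in linear_extensions T.
Proof.
case/stepP=> x [y [b [pxy bt w ->]]] sT.
have [lin ds] := linextP s sT.
apply/linextP; split=> [i j eij|v]; last by rewrite deco_of_swap.
have lij := lin _ _ eij.
rewrite place_swap_lt //; apply/eqP => -[ix jy]; subst i j; last first.
  by move: lij; rewrite pxy ltnNge leqnSn.
have gxy : g x y by rewrite /adjacent eij.
case/orP: w => /andP[db pb].
- by have := down_blocked sT gxy db bt; clear -pb pxy; lia.
- by have := up_blocked sT gxy db bt; clear -pb pxy; lia.
Qed.

(** The path from x to y in T is not monotone, because s and t order x and y
    differently. If it starts upwards then its first turn b is above x, hence
    after x in s, hence after y too since y comes right after x; and b
    separates x from y and has two children. The other case is symmetric. *)
Lemma inverted_wall s t x y :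
  s \in linear_extensions T -> t \in linear_extensions T ->
  place s y = (place s x).+1 :> nat -> place t y < place t x ->
  exists2 b : 'I_n, between x b y & wall s x y b.
Proof.
move=> sT tT pxy tyx.
have [lins ds] := linextP s sT; have [lint _] := linextP t tT.
have xy : x != y by apply: contraTneq tyx => ->; rewrite ltnn.
have /connectP[p0 /shortenP[p pp up _] yE] := adjacent_connect x y.
have : y \in p by have := mem_last x p; rewrite -yE inE eq_sym (negPf xy).
case: p pp up {yE} => // z q pp up yq.
have /= /andP[/orP[exz|ezx] _] := pp.
- case: (@before_or_turn _ g (children T) (permutree_descendants T)
    (fun u v => (place s u < place s v) && (place t u < place t v))
    _ adjacent_sym _ _ x y z q pp up _ yq).
  + move=> v u w /andP[A B] /andP[C D].
    by rewrite (ltn_trans A C) (ltn_trans B D).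
  + by move=> v u; rewrite -permutree_linked => e; rewrite lins // lint.
  + exact: adjacent_children.
  + by rewrite -permutree_linked.
  + by case/andP=> _; rewrite ltnNge ltnW.
  case=> b [tb bt /andP[xb _]]; exists b => //.
  rewrite /wall ds is_down_decoration tb /= ltn_neqAle pxy xb andbT.
  have /andP[_ by_] := between_neq bt.
  apply/orP; left; apply: contraNneq by_ => E.
  by apply/eqP/(@place_inj _ s)/val_inj => /=; rewrite pxy.
- case: (@before_or_turn _ g (parents T) (permutree_ancestors T)
    (fun u v => (place s v < place s u) && (place t v < place t u))
    _ adjacent_sym _ _ x y z q pp up _ yq) => //.
  + move=> v u w /andP[A B] /andP[C D].
    by rewrite (ltn_trans C A) (ltn_trans D B).
  + by move=> v u e; rewrite lins // lint.
  + exact: adjacent_parents.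
  + by case/andP; rewrite pxy ltnNge leqnSn.
  case=> b [tb bt /andP[xb _]]; exists b => //.
  by rewrite /wall ds is_up_decoration tb xb orbT.
Qed.

End Extensions.

Section Sorting.
Variable n : nat.

Lemma card_ord_lt (i : 'I_n) : #|[set p : 'I_n | p < i]| = i.
Proof.
have inj : injective (widen_ord (ltnW (ltn_ord i))).
  by move=> p q /(congr1 val) /= /val_inj.
rewrite cardsE -[RHS]card_ord -(card_codom inj).
apply: eq_card => p; apply/idP/codomP => [lt|[q ->]]; last exact: (ltn_ord q).
by exists (Ordinal (lt : p < i)); apply: val_inj.
Qed.

Lemma perm_rank (u : 'S_n) i : #|[set j | u j < u i]| = u i.
Proof.
rewrite -[RHS]card_ord_lt -(card_imset _ (@perm_inj _ u)).
apply: eq_card => p; rewrite !inE; apply/imsetP/idP => [[j]|lt].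
  by rewrite inE => lt ->.
by exists ((u^-1)%g p); rewrite ?inE permKV.
Qed.

Lemma perm_order_eq (u u' : 'S_n) :
  (forall i j, (u i < u j) = (u' i < u' j)) -> u = u'.
Proof.
move=> E; apply/permP => i; apply: val_inj.
apply: etrans (esym (perm_rank u i)) (etrans _ (perm_rank u' i)).
by apply: eq_card => j; rewrite !inE E.
Qed.

Implicit Types s t : dperm n.

Definition inversions s t : {set 'I_n * 'I_n} :=
  [set uv | (place s uv.1 < place s uv.2) && (place t uv.2 < place t uv.1)].

(** If t puts all the pairs of neighbours of s in the same order as s does, then
    by transitivity it puts all pairs in the same order. *)
Lemma adjacent_inversion s t : s.1 != t.1 ->
  exists x y : 'I_n, place s y = (place s x).+1 :> nat /\ place t y < place t x.
Proof.
move=> st.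
have [/forallP H|] := boolP [forall x, forall y,
   (place s y == (place s x).+1 :> nat) ==> (place t x < place t y)]; last first.
  rewrite negb_forall => /existsP[x]; rewrite negb_forall => /existsP[y].
  rewrite negb_imply => /andP[/eqP pxy]; rewrite -leqNgt leq_eqVlt.
  case/predU1P=> [/val_inj/place_inj xy|lt]; last by exists x, y.
  by move: pxy; rewrite xy => /n_Sn.
(* Induction on the distance of x and y in s. *)
have mono d x y : place s y = (place s x + d).+1 :> nat -> place t x < place t y.
  elim: d y => [|d IH] y pxy.
    by have /forallP/(_ y)/implyP-> // := H x; rewrite pxy addn0.
  have lt : place s x + d.+1 < n.
    by have := ltn_ord (place s y); rewrite pxy; apply: ltn_trans.
  pose z := s.1 (Ordinal lt).
  have pz : place s z = (place s x + d).+1 :> nat by rewrite place1 /= addnS.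
  apply: ltn_trans (IH z pz) _.
  by have /forallP/(_ y)/implyP-> // := H z; rewrite pz pxy addnS.
case/eqP: st; apply: (@invg_inj _); apply: perm_order_eq => x y.
rewrite -!/(place _ _).
have imp u w : place s u < place s w -> place t u < place t w.
  by move=> lt; apply: (mono (place s w - (place s u).+1)); clear -lt; lia.
apply/idP/idP => [|lt]; first exact: imp.
rewrite ltnNge leq_eqVlt; apply/negP => /predU1P[|gt].
  by move/val_inj/place_inj => E; rewrite E ltnn in lt.
by have := imp _ _ gt; clear -lt; lia.
Qed.

(** Sorting s into t by exchanges of neighbours that t inverts: such an exchange
    removes one inversion and creates none. *)
Lemma linext_connect (T : permutree n) s t :
  s \in linear_extensions T -> t \in linear_extensions T -> connect (@step n) s t.
Proof.
move=> + tT; have [k] := ubnP #|inversions s t|.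
elim: k s => // k IH s ltk sT.
have [st|/adjacent_inversion[x [y [pxy tyx]]]] := eqVneq s.1 t.1.
  suff -> : s = t by apply: connect0.
  apply: dperm_eqP => // v.
  by rewrite (linextP _ _ sT).2 (linextP _ _ tT).2.
have [b bt w] := inverted_wall sT tT pxy tyx.
have st : step s (swap s x y) by apply/stepP; exists x, y, b.
apply: connect_trans (connect1 st) _.
apply: IH; last exact: step_linext st sT.
apply: leq_trans _ (ltk : #|inversions s t| <= k); apply: proper_card.
apply/properP; split.
  apply/subsetP=> -[u v]; rewrite !inE /= => /andP[lt tvu]; rewrite tvu andbT.
  have [[-> ->]|uv] := eqVneq (u, v) (x, y); first by rewrite pxy ltnSn.
  rewrite -(place_swap_lt pxy uv) //; apply: contraTneq tvu => -[-> ->].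
  by rewrite ltnNge ltnW.
exists (x, y); rewrite !inE /= ?pxy ?ltnSn // !place_swap tpermL tpermR pxy.
by rewrite ltnNge leqnSn.
Qed.

End Sorting.

(** * A permutree for every decorated permutation *)

(** The letter v is drawn at abscissa v and height [pos v]; the predicates [dn]
    and [up] tell which letters have two children and two parents. *)
Section Insertion.
Variables (n : nat) (pos : 'I_n -> nat) (dn up : pred 'I_n).
Hypothesis pos_inj : injective pos.

(** The walls that cut the horizontal line just below height p: those rising
    from letters placed before p, and those hanging from letters placed at p or
    later. *)
Definition wall_at (p : nat) (b : 'I_n) : bool :=
  (up b && (pos b < p)) || (dn b && (p <= pos b)).

Definition visible (p : nat) (x y : 'I_n) : bool :=
  [forall b : 'I_n, between x b y ==> ~~ wall_at p b].

(** The edge from i up to j: i is the last letter placed on the strand that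
    arrives at j. When j has two children its own wall splits the line, two
    strands arrive at j, and a later letter k displaces i only if it is on the
    same side of j. *)
Definition covered : rel 'I_n := fun i j =>
  [&& pos i < pos j, visible (pos j) i j &
      [forall k : 'I_n, [&& pos i < pos k, pos k < pos j & visible (pos j) k j]
          ==> dn j && between k j i]].

Lemma visibleP p (x y : 'I_n) :
  reflect (forall b : 'I_n, between x b y -> ~~ wall_at p b) (visible p x y).
Proof. by apply: (iffP forallP) => H b; apply/implyP; apply: H. Qed.

Lemma coveredP i j :
  reflect [/\ pos i < pos j, visible (pos j) i j &
      forall k : 'I_n, pos i < pos k -> pos k < pos j -> visible (pos j) k j ->
        dn j && between k j i] (covered i j).
Proof.
apply: (iffP and3P) => -[? ? H]; split=> //.
  by move=> k ? ? ?; have /forallP/(_ k)/implyP := H; apply; apply/and3P.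
by apply/forallP => k; apply/implyP => /and3P[]; apply: H.
Qed.

(** The flag d is the vertical direction, upwards when it is true. Reversing the
    word exchanges the two directions, and most statements are needed in both. *)
Definition toward (d : bool) : rel 'I_n :=
  fun x y => if d then covered x y else covered y x.
Definition before (d : bool) : rel 'I_n :=
  fun x y => if d then pos x < pos y else pos y < pos x.
Definition forks (d : bool) (v : 'I_n) : bool := if d then up v else dn v.
Definition neighbor : rel 'I_n := fun x y => covered x y || covered y x.

Lemma toward_before d x y : toward d x y -> before d x y.
Proof. by case: d => /coveredP[]. Qed.

Lemma before_trans d : transitive (before d).
Proof. by case: d => y x z /= A B; [apply: ltn_trans A B|apply: ltn_trans B A]. Qed.

Lemma before_neq d x y : before d x y -> x != y :> nat.
Proof. by case: d => /= A; apply: contraTneq A => /val_inj->; rewrite ltnn. Qed.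

Lemma neighborE d x y : neighbor x y = toward d x y || toward (~~ d) x y.
Proof. by case: d => //; rewrite /neighbor orbC. Qed.

Lemma neighbor_sym : symmetric neighbor.
Proof. by move=> x y; rewrite /neighbor orbC. Qed.

Lemma towardN d x y : toward (~~ d) x y = toward d y x.
Proof. by case: d. Qed.

(** The edge would meet the wall of b at the height just below its upper end,
    where the definition of [covered] forbids it. *)
Lemma no_crossing d (b x y : 'I_n) :
  forks d b -> before d b x -> before d b y -> neighbor x y -> ~~ between x b y.
Proof.
move=> fb bx by_ /orP[] /coveredP[lt /visibleP vis _]; apply/negP => bt.
- have := vis b bt; rewrite /wall_at.
  by case: d fb bx by_ => /= -> bx by_; rewrite ?by_ ?(ltnW by_) ?orbT.
- rewrite /between orbC in bt.
  have := vis b bt; rewrite /wall_at.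
  by case: d fb bx by_ => /= -> bx by_; rewrite ?bx ?(ltnW bx) ?orbT.
Qed.

Lemma two_children (v x y : 'I_n) : covered x v -> covered y v -> pos x < pos y ->
  dn v && between x v y.
Proof.
move=> /coveredP[xv vx H] /coveredP[yv vy _] xy.
by rewrite /between orbC; apply: H.
Qed.

(** The definition of [covered] is asymmetric, so this is the mirror image of
    [two_children] that needs an argument. Suppose it fails. If no wall lies
    between x and y just below y, then x is visible from y; it would hide v from y
    unless y has two children and lies between x and v, but then the wall below y
    would have hidden v from x. Otherwise the wall between x and y that is nearest
    to v rises from a letter b placed between x and y, and b plays the role of x
    in the same argument. *)
Lemma two_parents (v x y : 'I_n) : covered v x -> covered v y -> pos x < pos y ->
  up v && between x v y.
Proof.
move=> /coveredP[vx /visibleP visx _] /coveredP[vy /visibleP visy H] xy.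
apply: contraT => nbt.
have ne (a b : 'I_n) : pos a < pos b -> a <> b :> nat.
  by move=> lt /val_inj E; rewrite E ltnn in lt.
have nx := ne _ _ vx; have ny := ne _ _ vy; have nxy := ne _ _ xy.
have [/existsP[b0 Hb0]|] :=
   boolP [exists b : 'I_n, between x b y && wall_at (pos y) b]; last first.
  rewrite negb_exists => /forallP H'.
  have vis : visible (pos y) x y.
    by apply/visibleP => b bt; have := H' b; rewrite bt.
  have /andP[dy bt] := H _ vx xy vis.
  have /visx : between v y x.
    by move: bt nbt nxy; rewrite /between; clear; lia.
  by rewrite /wall_at dy (ltnW xy) orbT.
(* The wall nearest to v, among those between x and y. *)
pose dist (b : 'I_n) := (b - v) + (v - b).
case: (arg_minnP (P := fun b : 'I_n => between x b y && wall_at (pos y) b)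
  dist Hb0).
move=> b /andP[bt wb] bmin.
have bv : b <> v.
  move=> bv; subst b; move: nbt; rewrite bt andbT.
  by move: wb; rewrite /wall_at [pos y <= _]leqNgt vy andbF orbF => /andP[->].
have bv' : b <> v :> nat by move/val_inj.
have nvb : ~~ between v b y by apply: contraL wb => /visy.
have xbv : between v b x.
  by move: bt nvb bv'; rewrite /between; clear; lia.
have upb : up b && (pos x < pos b < pos y).
  have := visx _ xbv; rewrite /wall_at negb_or.
  have bx : b <> x :> nat by move: xbv; rewrite /between; clear; lia.
  have pbx : pos b <> pos x by move/pos_inj => E; apply: bx; rewrite E.
  move: wb; rewrite /wall_at; case/orP => /andP[-> lt] /=.
    by rewrite lt andbT => /andP[pb _]; move: pb pbx; clear; lia.
  by rewrite (leq_trans (ltnW xy) lt) andbF.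
have /andP[_ /andP[xb yb]] := upb.
suff vis : visible (pos y) b y.
  have /andP[dy byv] := H _ (ltn_trans vx xb) yb vis.
  have /visx : between v y x by move: xbv byv; rewrite /between; clear; lia.
  by rewrite /wall_at dy (ltnW xy) orbT.
apply/visibleP => c bcy; apply/negP => wc.
have ncy : ~~ between v c y by apply: contraL wc => /visy.
have nc : c <> v :> nat.
  move/val_inj => E; subst c; move: wc.
  have nv : ~~ up v.
    by apply: contra nbt => ->; move: bcy bt; rewrite /between; clear; lia.
  by rewrite /wall_at (negPf nv) [pos y <= _]leqNgt vy andbF.
have xcy : between x c y by move: bcy bt; rewrite /between; clear; lia.
have := bmin c; rewrite xcy wc => /(_ isT).
by move: bcy ncy nc xbv bt; rewrite /dist /between; clear; lia.
Qed.

Lemma turn_forks d (v x y : 'I_n) : toward d v x -> toward d v y -> x != y ->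
  forks d v && between x v y.
Proof.
move=> tx ty xy.
have : pos x != pos y by apply: contraNneq xy => /pos_inj->.
rewrite neq_ltn => /orP[] lt; last rewrite /between orbC -/(between y v x).
- by case: d tx ty => /= A B; [apply: two_parents|apply: two_children].
- by case: d tx ty => /= A B; [apply: two_parents|apply: two_children].
Qed.

(** Every edge of the chain lies beyond b, where [no_crossing] applies. *)
Lemma chain_side d (b y : 'I_n) c :
  forks d b -> before d b y -> path (toward d) y c ->
  ~~ between y b (last y c).
Proof.
move=> fb; elim: c y => [|z c IH] y by_ /=.
  by move=> _; rewrite /between; clear; lia.
case/andP=> yz pc.
have bz := before_trans by_ (toward_before yz).
have := no_crossing fb by_ bz; rewrite (neighborE d) yz => /(_ isT).
have := IH z bz pc; have := before_neq bz.
by rewrite /between; clear; lia.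
Qed.

(** Induction along a path that leaves v0 through v1. The vertex u is the
    current one and c is the monotone part of the path that led from v0 to u, read
    backwards; as long as the path goes on in direction d, the wall of v0 keeps it
    on the side of v1. If it turns at u, then u has a wall in the opposite
    direction; v0 and what follows u are on different sides of that wall, by
    [chain_side] and by the induction hypothesis with u in the role of v0. So what
    follows is separated from v0 by u, which is on the side of v1. *)
Lemma branch_side_from q d (v0 v1 u : 'I_n) c :
  c != [::] -> path (toward (~~ d)) u c -> last u c = v0 -> path neighbor u q ->
  uniq (c ++ u :: q) -> forks d v0 -> before d v0 u -> ~~ between v1 v0 u ->
  ~~ between v1 v0 (last u q).
Proof.
elim: q d v0 v1 u c => [//|y q IH] d v0 v1 u c cn pc lc.
move=> /= /andP[guy pq] uq fv0 v0u s1.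
have [tuy|ntuy] := boolP (toward d u y).
  apply: (IH d v0 v1 y (u :: c)) => //=.
  - by rewrite towardN tuy.
  - by have /= <- := uniq_catCA c [:: u] (y :: q).
  - exact: before_trans v0u (toward_before tuy).
  - have v0y := before_trans v0u (toward_before tuy).
    have := no_crossing fv0 v0u v0y guy.
    by move: s1 (before_neq v0u); rewrite /between; clear; lia.
have tuy' : toward (~~ d) u y by move: guy; rewrite (neighborE d) (negPf ntuy).
case: c cn pc lc uq => // x c _ /= /andP[tux pc] lc uq.
have xy : x != y.
  by case/andP: uq => + _; rewrite mem_cat !inE !negb_or => /and4P[].
have /andP[fu bt] := turn_forks tux tuy' xy.
have ylast : ~~ between y u (last y q).
  apply: (IH (~~ d) u y y [:: u]) => //=.
  - by rewrite towardN tuy'.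
  - by move: uq; rewrite cat_uniq => /and4P[].
  - exact: toward_before tuy'.
  - by rewrite /between; clear; lia.
have := chain_side fu (toward_before tux) pc; rewrite lc.
move: bt ylast s1 (before_neq v0u); rewrite /between; clear; lia.
Qed.

Lemma branch_side d (v0 v1 : 'I_n) q :
  forks d v0 -> toward d v0 v1 -> path neighbor v1 q -> uniq (v0 :: v1 :: q) ->
  ~~ between v1 v0 (last v1 q).
Proof.
move=> f0 t01 pq uq; apply: (@branch_side_from q d v0 v1 v1 [:: v0]) => //=.
- by rewrite towardN t01.
- exact: toward_before.
- by rewrite /between; clear; lia.
Qed.

(** The highest vertex of a cycle of length at least 3 has two children on it,
    hence on both sides of it, although the rest of the cycle is a path that
    stays on one side. *)
Lemma neighbor_acyclic (c : seq 'I_n) : ucycle neighbor c -> size c <= 2.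
Proof.
case/andP=> cc uc; rewrite leqNgt; apply/negP => sc.
case: c sc cc uc => // a0 c0; set c := a0 :: c0 => sc cc uc.
have a0c : a0 \in c by apply: mem_head.
case: (arg_maxnP (P := mem c) pos a0c) => j jc jmax.
have [i p E] := rot_to jc.
have gc : path.cycle neighbor (j :: p) by rewrite -E rot_cycle.
have up' : uniq (j :: p) by rewrite -E rot_uniq.
have sp : 2 < size (j :: p) by rewrite -E size_rot.
have pmem z : z \in p -> z \in c by rewrite -(mem_rot i c) E inE orbC => ->.
case: p {E} gc up' sp pmem => // x [//|z p]; rewrite (cycle_path j) /=.
set y := last z p => /and4P[gyj gjx gxz pp] uq _ pmem.
have yp : y \in z :: p by apply: mem_last.
have lt w : w \in x :: z :: p -> pos w < pos j.
  move=> wp; have /= le := jmax w (pmem w wp); rewrite ltn_neqAle le andbT.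
  by apply: contraTneq wp => /pos_inj->; case/andP: uq.
have cov w : w \in x :: z :: p -> neighbor j w -> toward false j w.
  move=> wp /orP[] // /coveredP[+ _ _]; rewrite ltnNge.
  by rewrite ltnW ?lt.
have tx := cov x (mem_head _ _) gjx.
have ty : toward false j y.
  by apply: cov; [rewrite in_cons yp orbT|rewrite neighbor_sym].
have xy : x != y.
  by apply: contraTneq yp => <-; case/and3P: uq.
have /andP[fj bt] := turn_forks tx ty xy.
have := @branch_side false j x (z :: p) fj tx _ uq.
by rewrite /= gxz pp -/y bt => /(_ isT).
Qed.

(** Among the letters below height t, those that no hanging wall separates at
    height t are connected. When the letter j of height t is added, it has to be
    attached to each z that it sees past the remaining hanging walls: j covers the
    last letter i on the strand on the side of z, and i is connected to z by
    induction. *)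
Lemma neighbor_connect_upto t (x y : 'I_n) : pos x < t -> pos y < t ->
  (forall b : 'I_n, dn b -> t <= pos b -> ~~ between x b y) ->
  connect neighbor x y.
Proof.
have csym := sym_connect_sym neighbor_sym.
elim: t x y => // t IH x y.
have key (z j : 'I_n) : pos z < t -> pos j = t ->
    (forall b : 'I_n, dn b -> t < pos b -> ~~ between z b j) ->
    connect neighbor z j.
  move=> zt jt Hb.
  have zj : z <> j :> nat by move/val_inj => E; rewrite E jt ltnn in zt.
  pose K (k : 'I_n) := [&& pos k < t, visible t k j & dn j ==> ~~ between k j z].
  have [k0 Kk0] : exists k, K k.
    (* The strand at j on the side of z is bounded by the first rising wall on
       the way to z; its letter is a candidate, and so is z if there is none. *)
    pose dist (b : 'I_n) := (b - j) + (j - b).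
    pose W (k : 'I_n) := (k == z) || [&& up k, pos k < t & between z k j].
    have Wz : W z by rewrite /W eqxx.
    case: (arg_minnP dist Wz) => k Wk kmin; exists k.
    have kzj : k = z :> nat \/ between z k j.
      by case/orP: Wk => [/eqP->|/and3P[]]; [left|right].
    apply/and3P; split.
    - by case/orP: Wk => [/eqP->|/and3P[]].
    - apply/visibleP => b kbj.
      have zbj : between z b j by move: kbj kzj; rewrite /between; clear; lia.
      apply/negP => /orP[] /andP[Hd Hp].
      + have := kmin b; rewrite /W Hd Hp zbj orbT => /(_ isT).
        by move: kbj; rewrite /dist /between; clear; lia.
      + have /(Hb b Hd) : t < pos b.
          rewrite ltn_neqAle Hp andbT -jt.
          by apply: contraTneq zbj => /pos_inj->; rewrite /between; clear; lia.
        by rewrite zbj.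
    - by apply/implyP => _; move: kzj zj; rewrite /between; clear; lia.
  case: (arg_maxnP pos Kk0) => i /and3P[it vis sd] imax.
  have ij : i <> j :> nat by move/val_inj => E; rewrite E jt ltnn in it.
  have cij : covered i j.
    apply/coveredP; rewrite jt; split=> // k ik kt vk.
    have : ~~ K k.
      by apply/negP => /imax /=; rewrite leqNgt ik.
    rewrite /K kt vk /= negb_imply negbK => /andP[dj bt]; rewrite dj /=.
    by move: sd; rewrite dj /=; move: bt ij zj; rewrite /between; clear; lia.
  apply: (@connect_trans _ _ i); last by apply: connect1; rewrite /neighbor cij.
  apply: IH => // b db tb; apply/negP => bt.
  have [bj|bj] := eqVneq b j.
    subst b; move: sd; rewrite db /=.
    by move: bt; rewrite /between; clear; lia.
  have tb' : t < pos b.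
    by rewrite ltn_neqAle tb andbT -jt; apply: contraNneq bj => /pos_inj->.
  have := Hb b db tb'.
  have nib : ~~ between i b j.
    apply/negP => /(visibleP _ _ _ vis); rewrite /wall_at db tb orbT //.
  have bj' : b <> j :> nat by move/val_inj/eqP; rewrite (negPf bj).
  by move: bt nib bj'; rewrite /between; clear; lia.
rewrite ltnS leq_eqVlt => /predU1P xt; rewrite ltnS leq_eqVlt => /predU1P yt.
case: xt yt => [xt|xt] [yt|yt] Hb.
- by rewrite (pos_inj (etrans xt (esym yt))) connect0.
- rewrite csym; apply: key => // b db tb; rewrite /between orbC.
  exact: Hb.
- exact: key.
have [/existsP[j /and3P[/eqP jt dj bt]]|] :=
   boolP [exists j : 'I_n, [&& pos j == t, dn j & between x j y]].
  apply: (@connect_trans _ _ j).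
    apply: key => // b db tb; have := Hb b db tb.
    by move: bt; rewrite /between; clear; lia.
  rewrite csym; apply: key => // b db tb; have := Hb b db tb.
  by move: bt; rewrite /between; clear; lia.
rewrite negb_exists => /forallP nj.
apply: IH => // b db; rewrite leq_eqVlt => /predU1P[bt|]; last exact: Hb.
by have := nj b; rewrite -bt eqxx db.
Qed.

Lemma neighbor_connect x y : connect neighbor x y.
Proof.
pose t := (\max_(z : 'I_n) pos z).+1.
have lt z : pos z < t by rewrite ltnS leq_bigmax.
by apply: (@neighbor_connect_upto t) => // b _; rewrite leqNgt lt.
Qed.

Definition fork_slots (d : bool) (i : 'I_n) : slots n :=
  if forks d i
  then Two [pick j | toward d i j && (j < i)] [pick j | toward d i j && (i < j)]
  else One [pick j | toward d i j].

Lemma linked_fork_slots d i j : linked (fork_slots d i) j = toward d i j.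
Proof.
have uniq_nb x y : toward d i x -> toward d i y ->
    ~~ (forks d i && between x i y) -> x = y.
  by move=> tx ty; apply: contraNeq; apply: turn_forks.
rewrite /fork_slots; case: ifP => fi /=; last first.
  case: pickP => [x tx|H]; last by rewrite H.
  apply/eqP/idP => [[<-] //|tj]; congr Some; apply: uniq_nb => //.
  by rewrite fi.
have ne : toward d i j -> i <> j :> nat.
  by move/toward_before/before_neq/eqP.
have pickN (r : pred 'I_n) : r j = false -> ([pick x | r x] == Some j) = false.
  by move=> rj; case: pickP => // x rx; apply/eqP => -[E]; rewrite E rj in rx.
(* At most one neighbour lies on each side of i, so a pick finds it. *)
have [ij|ji|/val_inj ij] := ltngtP i j.
- rewrite pickN ?(ltnNge j) ?(ltnW ij) ?andbF //=.
  case: pickP => [x /andP[tx ix]|/(_ j)]; last by rewrite ij andbT.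
  apply/eqP/idP => [[<-] //|tj]; congr Some; apply: uniq_nb => //.
  by rewrite fi /=; move: ij ix; rewrite /between; clear; lia.
- rewrite orbC pickN ?(ltnNge i) ?(ltnW ji) ?andbF //=.
  case: pickP => [x /andP[tx ix]|/(_ j)]; last by rewrite ji andbT.
  apply/eqP/idP => [[<-] //|tj]; congr Some; apply: uniq_nb => //.
  by rewrite fi /=; move: ji ix; rewrite /between; clear; lia.
- subst j; have -> : toward d i i = false by apply/negP => /ne.
  by rewrite !pickN // ltnn andbF.
Qed.

Lemma fork_slots_sides (g : rel 'I_n) d i :
  g =2 neighbor -> left_right g i (fork_slots d i).
Proof.
move=> gE; rewrite /fork_slots; case: ifP => fi //=.
have side p j : toward d i p -> branch g i (Some p) j ->
    ~~ between p i j /\ i <> j :> nat.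
  move=> tp /connectP[q0 /shortenP[q pq uq _] ->].
  have pi := before_neq (toward_before tp).
  have [pq' iq] : path neighbor p q /\ i \notin q.
    elim: q p pq {uq tp pi} => //= y q IH p /andP[/and3P[pi yi gpy] pq].
    have [pq' iq] := IH y pq.
    by rewrite -gE gpy pq' inE negb_or eq_sym yi iq.
  have ipq : i \notin p :: q.
    by rewrite inE negb_or iq andbT -val_eqE.
  split; first by apply: (branch_side fi tp pq'); apply/andP; split.
  by move/val_inj => E; move: ipq; rewrite {1}E mem_last.
split=> j; case: pickP => // p /andP[tp lt] /(side _ _ tp).
- by move=> [+ ne]; move: lt ne; rewrite /between; clear; lia.
- by move=> [+ ne]; move: lt ne; rewrite /between; clear; lia.
Qed.

Lemma edge_fork_slots i j : edge (fork_slots true) i j = covered i j.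
Proof. by rewrite /edge linked_fork_slots. Qed.

Lemma adjacent_fork_slots : adjacent (fork_slots true) =2 neighbor.
Proof. by move=> i j; rewrite /adjacent !edge_fork_slots. Qed.

Lemma fork_linked i j :
  linked (fork_slots true i) j = linked (fork_slots false j) i.
Proof. by rewrite !linked_fork_slots. Qed.

Lemma fork_simple i j :
  ~~ (edge (fork_slots true) i j && edge (fork_slots true) j i).
Proof.
rewrite !edge_fork_slots; apply/negP => /andP[/coveredP[A _ _] /coveredP[B _ _]].
by move: A B; clear; lia.
Qed.

Lemma fork_tree : is_tree (adjacent (fork_slots true)).
Proof.
split=> [i|i j|c].
- rewrite adjacent_fork_slots /neighbor orbb.
  by apply/negP => /coveredP[]; rewrite ltnn.
- by rewrite (eq_connect adjacent_fork_slots) neighbor_connect.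
- rewrite /ucycle (eq_cycle adjacent_fork_slots); exact: neighbor_acyclic.
Qed.

Definition insertion_tree : permutree n :=
  @Permutree n (fork_slots true) (fork_slots false) fork_linked fork_simple
    fork_tree
    (fun i => fork_slots_sides true i adjacent_fork_slots)
    (fun i => fork_slots_sides false i adjacent_fork_slots).

End Insertion.

Lemma exists_permutree n (s : dperm n) :
  exists T : permutree n, s \in linear_extensions T.
Proof.
have pos_inj : injective (fun v => place s v : nat).
  by move=> u v /val_inj/place_inj.
exists (insertion_tree (fun v => is_down (deco_of s v))
          (fun v => is_up (deco_of s v)) pos_inj).
apply/linextP; split=> [i j|v].
  by rewrite (edge_fork_slots _ _ pos_inj) => /coveredP[].
rewrite /decoration /= /fork_slots /=.
by case: (deco_of s v).
Qed.

(** * Patterns on intervals of positions and of values *)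

Section Standardization.

(** Only the order property [standardizeE] is used, whence the definition by a
    choice. *)
Definition standardize n (f : nat -> nat) : 'S_n :=
  odflt 1%g [pick u : 'S_n | [forall i, forall j, (u i < u j) == (f i < f j)]].

(** The permutation sought sends i to the rank of f i among the values of f. *)
Lemma standardizeE n (f : nat -> nat) : injective f ->
  forall i j, (standardize n f i < standardize n f j) = (f i < f j).
Proof.
move=> inj_f; rewrite /standardize.
case: pickP => [u /forallP H i j|none]; first by have /forallP/(_ j)/eqP := H i.
have lt_rank (i : 'I_n) : #|[set j : 'I_n | f j < f i]| < n.
  rewrite -[X in _ < X]card_ord -cardsT; apply: proper_card.
  by apply/properP; split; [exact: subsetT|exists i; rewrite !inE // ltnn].
pose r i := Ordinal (lt_rank i).
have r_lt (i j : 'I_n) : f i < f j -> r i < r j.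
  move=> lt; apply: proper_card; apply/properP; split.
    by apply/subsetP => k; rewrite !inE => /ltn_trans; apply.
  by exists i; rewrite !inE ?ltnn.
have r_mono (i j : 'I_n) : (r i < r j) = (f i < f j).
  apply/idP/idP => [|/r_lt] //; rewrite ltnNge (ltnNge (f i)).
  by apply: contra; rewrite leq_eqVlt => /predU1P[/inj_f/val_inj->|/r_lt/ltnW].
have r_inj : injective r.
  move=> i j E; apply/val_inj/inj_f.
  by case: (ltngtP (f i) (f j)) => // /r_lt; rewrite E ltnn.
have /negP[] := negbT (none (perm r_inj)).
by apply/forallP => i; apply/forallP => j; rewrite !permE r_mono.
Qed.

Lemma dperm_order_eq n (t t' : dperm n) :
  (forall i j, (t.1 i < t.1 j) = (t'.1 i < t'.1 j)) -> t.2 =1 t'.2 -> t = t'.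
Proof.
case: t t' => [u d] [u' d'] /= /perm_order_eq-> dd.
by congr pair; apply/ffunP.
Qed.

(** Extending a permutation by the identity beyond its size keeps [letter t]
    injective on all of nat, so that patterns can be standardized without
    conditions on their range. *)
Definition letter n (t : dperm n) (i : nat) : nat :=
  oapp (fun p => t.1 p : nat) i (insub i).

Definition mark n (t : dperm n) (i : nat) : deco := oapp t.2 decoN (insub i).

Lemma letter_ord n (t : dperm n) (p : 'I_n) : letter t p = t.1 p.
Proof. by rewrite /letter valK. Qed.

Lemma mark_ord n (t : dperm n) (p : 'I_n) : mark t p = t.2 p.
Proof. by rewrite /mark valK. Qed.

Lemma letter_inj n (t : dperm n) : injective (letter t).
Proof.
move=> i j; rewrite /letter.
case: insubP => [p _ <-|ni]; case: insubP => [q _ <-|nj] //=.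
- by move/val_inj/perm_inj->.
- by move=> E; rewrite -E ltn_ord in nj.
- by move=> E; rewrite E ltn_ord in ni.
Qed.

(** The pattern of t on the l positions that start at a. *)
Definition segment n (t : dperm n) (a l : nat) : dperm l :=
  (standardize l (fun i => letter t (a + i)), [ffun i : 'I_l => mark t (a + i)]).

Lemma segment_lt n (t : dperm n) a l (i j : 'I_l) :
  ((segment t a l).1 i < (segment t a l).1 j)
  = (letter t (a + i) < letter t (a + j)).
Proof. by rewrite standardizeE // => x y /letter_inj/addnI. Qed.

Lemma segment_mark n (t : dperm n) a l (i : 'I_l) :
  (segment t a l).2 i = mark t (a + i).
Proof. by rewrite ffunE. Qed.

Lemma segment_eq n n' (t : dperm n) (t' : dperm n') a a' l :
  (forall i j, i < l -> j < l -> (letter t (a + i) < letter t (a + j))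
      = (letter t' (a' + i) < letter t' (a' + j))) ->
  (forall i, i < l -> mark t (a + i) = mark t' (a' + i)) ->
  segment t a l = segment t' a' l.
Proof.
move=> H1 H2; apply: dperm_order_eq => [i j|i].
  by rewrite !segment_lt; apply: H1.
by rewrite !segment_mark; apply: H2.
Qed.

Lemma segment_segment n (t : dperm n) a l b k :
  b + k <= l -> segment (segment t a l) b k = segment t (a + b) k.
Proof.
move=> le; have ltl i : i < k -> b + i < l.
  by move=> lt; apply: leq_trans le; rewrite ltn_add2l.
apply: segment_eq => [i j /ltl li /ltl lj|i /ltl li].
  rewrite -!addnA (letter_ord _ (Ordinal li)) (letter_ord _ (Ordinal lj)).
  by rewrite segment_lt.
by rewrite -addnA (mark_ord _ (Ordinal li)) segment_mark.
Qed.

Lemma segment_full n (t : dperm n) : segment t 0 n = t.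
Proof.
apply: dperm_order_eq => [i j|i]; first by rewrite segment_lt !letter_ord.
by rewrite segment_mark mark_ord.
Qed.

(** Exchanging positions and values turns shuffles into convolutions, so that
    each fact on restriction to positions gives one on restriction to values. *)
Definition dual n (t : dperm n) : dperm n :=
  ((t.1^-1)%g, [ffun v => deco_of t v]).

Lemma dual_dual n : involutive (@dual n).
Proof.
move=> [u d]; congr pair; first by rewrite /= invgK.
apply/ffunP => p; rewrite ffunE /deco_of ffunE /place /= invgK.
by rewrite /deco_of (place1 (u, d)).
Qed.

Lemma deco_of_dual n (t : dperm n) v : deco_of (dual t) v = t.2 v.
Proof. by rewrite -{2}[t]dual_dual /= ffunE. Qed.

Lemma place_dual n (t : dperm n) v : place (dual t) v = t.1 v.
Proof. by rewrite /place /= invgK. Qed.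

(** The pattern of t on the l values that start at a. *)
Definition block n (t : dperm n) (a l : nat) : dperm l :=
  dual (segment (dual t) a l).

Lemma block_block n (t : dperm n) a l b k :
  b + k <= l -> block (block t a l) b k = block t (a + b) k.
Proof. by move=> le; rewrite /block dual_dual segment_segment. Qed.

Lemma block_full n (t : dperm n) : block t 0 n = t.
Proof. by rewrite /block segment_full dual_dual. Qed.

End Standardization.

Section Convolution.
Variables k l : nat.

Lemma grassmannianP (w : 'S_(k + l)) :
  reflect ((forall i j : 'I_k, i < j -> w (lshift l i) < w (lshift l j)) /\
           (forall i j : 'I_l, i < j -> w (rshift k i) < w (rshift k j)))
          (w \in grassmannian k l).
Proof.
rewrite inE; apply: (iffP andP) => -[H1 H2]; split.
- by move=> i j; move/forallP/(_ i)/forallP/(_ j)/implyP: H1.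
- by move=> i j; move/forallP/(_ i)/forallP/(_ j)/implyP: H2.
- by apply/forallP => i; apply/forallP => j; apply/implyP; apply: H1.
- by apply/forallP => i; apply/forallP => j; apply/implyP; apply: H2.
Qed.

Lemma increasing_mono m (f : 'I_m -> 'I_(k + l)) :
  (forall i j : 'I_m, i < j -> f i < f j) ->
  forall i j, (f i < f j) = (i < j).
Proof.
move=> H i j; apply/idP/idP => [|/H] //; rewrite ltnNge (ltnNge i).
by apply: contra; rewrite leq_eqVlt => /predU1P[/val_inj->|/H/ltnW].
Qed.

Lemma shift_concat_lshift (s : 'S_k) (s' : 'S_l) i :
  shift_concat s s' (lshift l i) = lshift l (s i).
Proof. by rewrite permE /shift_concat_fun (unsplitK (inl i)). Qed.

Lemma shift_concat_rshift (s : 'S_k) (s' : 'S_l) i :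
  shift_concat s s' (rshift k i) = rshift k (s' i).
Proof. by rewrite permE /shift_concat_fun (unsplitK (inr i)). Qed.

Lemma deco_concat_lshift (d : {ffun 'I_k -> deco}) (d' : {ffun 'I_l -> deco}) i :
  deco_concat d d' (lshift l i) = d i.
Proof. by rewrite ffunE (unsplitK (inl i)). Qed.

Lemma deco_concat_rshift (d : {ffun 'I_k -> deco}) (d' : {ffun 'I_l -> deco}) i :
  deco_concat d d' (rshift k i) = d' i.
Proof. by rewrite ffunE (unsplitK (inr i)). Qed.

Lemma shift_concatV (s : 'S_k) (s' : 'S_l) :
  ((shift_concat s s')^-1 = shift_concat s^-1 s'^-1)%g.
Proof.
apply/permP => p; apply: (can_inj (permK (shift_concat s s'))); rewrite permKV.
by case: (split_ordP p) => i ->;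
  rewrite ?shift_concat_lshift ?shift_concat_rshift permKV.
Qed.

(** A Grassmannian permutation is increasing on the first k and on the last l
    positions, so it does not change the two patterns; conversely it is recovered
    from r as the quotient by the concatenation of the patterns. *)
Lemma in_convolution (t : dperm k) (t' : dperm l) r :
  (r \in convolution t t') = (segment r 0 k == t) && (segment r k l == t').
Proof.
have lt0 i j : ((segment r 0 k).1 i < (segment r 0 k).1 j)
    = (r.1 (lshift l i) < r.1 (lshift l j)).
  by rewrite segment_lt -!letter_ord.
have ltk i j : ((segment r k l).1 i < (segment r k l).1 j)
    = (r.1 (rshift k i) < r.1 (rshift k j)).
  by rewrite segment_lt -!letter_ord.
have mk0 i : (segment r 0 k).2 i = r.2 (lshift l i).
  by rewrite segment_mark -mark_ord.
have mkk i : (segment r k l).2 i = r.2 (rshift k i).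
  by rewrite segment_mark -mark_ord.
apply/imsetP/andP => [[w /grassmannianP[w0 wk] E]|[/eqP E0 /eqP Ek]].
  split; apply/eqP/dperm_order_eq => [i j|i]; rewrite ?(lt0, ltk, mk0, mkk) E /=.
  - by rewrite !permM !shift_concat_lshift (increasing_mono w0).
  - by rewrite deco_concat_lshift.
  - by rewrite !permM !shift_concat_rshift (increasing_mono wk).
  - by rewrite deco_concat_rshift.
exists ((shift_concat t.1 t'.1)^-1 * r.1)%g.
  apply/grassmannianP; split=> i j lt; rewrite !permM shift_concatV.
  - by rewrite !shift_concat_lshift -lt0 E0 !permKV.
  - by rewrite !shift_concat_rshift -ltk Ek !permKV.
case: r E0 Ek {lt0 ltk} mk0 mkk => u d /= E0 Ek mk0 mkk.
congr pair; first by rewrite mulKVg.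
apply/ffunP => p; case: (split_ordP p) => i ->.
- by rewrite deco_concat_lshift -E0 mk0.
- by rewrite deco_concat_rshift -Ek mkk.
Qed.

Lemma shuffle_convolution (t : dperm k) (t' : dperm l) r :
  (r \in shifted_shuffle t t') = (dual r \in convolution (dual t) (dual t')).
Proof.
have dualE w : dual ((w^-1 * shift_concat t.1 t'.1)%g,
    [ffun p => deco_concat t.2 t'.2 ((w^-1)%g p)])
    = ((shift_concat (dual t).1 (dual t').1 * w)%g,
       deco_concat (dual t).2 (dual t').2).
  congr pair; first by rewrite /= invMg invgK shift_concatV.
  apply/ffunP => p; rewrite ffunE /deco_of ffunE /place /= invMg invgK permM permK.
  rewrite shift_concatV; case: (split_ordP p) => i ->.
  - by rewrite shift_concat_lshift !deco_concat_lshift ffunE.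
  - by rewrite shift_concat_rshift !deco_concat_rshift ffunE.
apply/imsetP/imsetP => -[w wg E]; exists w => //.
  by rewrite E dualE.
by rewrite -[LHS]dual_dual E -dualE dual_dual.
Qed.

Lemma in_shuffle (t : dperm k) (t' : dperm l) r :
  (r \in shifted_shuffle t t') = (block r 0 k == t) && (block r k l == t').
Proof.
rewrite shuffle_convolution in_convolution /block.
by rewrite (inv_eq (@dual_dual k)) (inv_eq (@dual_dual l)).
Qed.

End Convolution.

(** * Compatibility of steps with patterns and with convolution *)

Lemma place_eq n (s t : dperm n) :
  place s =1 place t -> deco_of s =1 deco_of t -> s = t.
Proof.
move=> H; apply: dperm_eqP; apply: invg_inj; apply/permP => v.
exact: H.
Qed.

Lemma place_order_eq n (s t : dperm n) :
  (forall i j, (place s i < place s j) = (place t i < place t j)) ->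
  deco_of s =1 deco_of t -> s = t.
Proof.
move=> H D; apply: place_eq => // v.
by rewrite /place; congr (fun_of_perm _ v); apply: perm_order_eq.
Qed.

(** This is how places that are consecutive in a word are recognized in a
    pattern of it. *)
Lemma place_consecutive n (s : dperm n) x y : place s x < place s y ->
  (forall z, ~~ (place s x < place s z < place s y)) ->
  place s y = (place s x).+1 :> nat.
Proof.
move=> lt H; apply/eqP; rewrite eqn_leq lt andbT leqNgt; apply/negP => gt.
have lt' : (place s x).+1 < n by apply: ltn_trans gt (ltn_ord _).
by have := H (s.1 (Ordinal lt')); rewrite place1 /= gt ltnSn.
Qed.

Section BlockStep.
Variables (n a l : nat).
Hypothesis le_al : a + l <= n.
Implicit Types s t : dperm n.

Lemma widen_block_proof (i : 'I_l) : a + i < n.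
Proof. by apply: leq_trans le_al; rewrite ltn_add2l. Qed.

Definition widen_block (i : 'I_l) : 'I_n := Ordinal (widen_block_proof i).

Lemma widen_block_inj : injective widen_block.
Proof. by move=> i j /(congr1 val) /= /addnI/val_inj. Qed.

Lemma place_block_lt s i j :
  (place (block s a l) i < place (block s a l) j)
  = (place s (widen_block i) < place s (widen_block j)).
Proof.
rewrite /block !place_dual segment_lt.
by rewrite (letter_ord _ (widen_block i)) (letter_ord _ (widen_block j)).
Qed.

Lemma deco_of_block s i : deco_of (block s a l) i = deco_of s (widen_block i).
Proof.
by rewrite /block deco_of_dual segment_mark (mark_ord _ (widen_block i)) ffunE.
Qed.

(** If x and y both belong to the block, so does the witness, whose value lies
    between theirs. Otherwise the letters of the block keep their order. *)
Lemma block_step s t : step s t ->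
  block s a l = block t a l \/ step (block s a l) (block t a l).
Proof.
case/stepP=> x [y [b [pxy bt w ->]]].
have same : (forall i j, (widen_block i, widen_block j) != (x, y)) ->
    block s a l = block (swap s x y) a l.
  move=> H; apply: place_order_eq => [i j|i].
    by rewrite !place_block_lt place_swap_lt ?H // xpair_eqE andbC -xpair_eqE H.
  by rewrite !deco_of_block deco_of_swap.
have [/existsP[x' /eqP xE]|nx] := boolP [exists i, x == widen_block i];
  [have [/existsP[y' /eqP yE]|ny] := boolP [exists i, y == widen_block i]|].
- right; subst x y.
  have [b' bE] : exists b', b = widen_block b'.
    have lt : b - a < l.
      by move: bt (ltn_ord x') (ltn_ord y'); rewrite /between /=; clear; lia.
    exists (Ordinal lt); apply: val_inj => /=.
    by move: bt; rewrite /between /=; clear; lia.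
  subst b; apply/stepP; exists x', y', b'; split.
  + apply: place_consecutive => [|z]; first by rewrite place_block_lt pxy.
    by rewrite !place_block_lt pxy; clear; lia.
  + by move: bt; rewrite /between /=; clear; lia.
  + by move: w; rewrite /wall !deco_of_block !place_block_lt.
  + apply: place_order_eq => [i j|i].
      rewrite !place_swap !place_block_lt !place_swap.
      by rewrite !(inj_tperm _ _ _ widen_block_inj).
    by rewrite deco_of_swap !deco_of_block deco_of_swap.
- left; apply: same => i j; rewrite xpair_eqE andbC.
  by move/existsPn/(_ j): ny; rewrite eq_sym => /negPf->.
- left; apply: same => i j; rewrite xpair_eqE.
  by move/existsPn/(_ i): nx; rewrite eq_sym => /negPf->.
Qed.

End BlockStep.

(** Here s is carried into r by an increasing map f of values and a translation h
    of positions, and r' differs from r only in that s' is carried instead. *)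
Section Embedding.
Variables (m n c : nat) (f : 'I_m -> 'I_n) (h : 'I_m -> 'I_n).
Variables (s s' : dperm m) (r r' : dperm n).
Hypothesis f_incr : forall i j, (f i < f j) = (i < j).
Hypothesis hE : forall p, h p = c + p :> nat.
Hypothesis place_f : forall v, place r (f v) = h (place s v).
Hypothesis place_f' : forall v, place r' (f v) = h (place s' v).
Hypothesis deco_f : forall v, deco_of r (f v) = deco_of s v.
Hypothesis deco_f' : forall v, deco_of r' (f v) = deco_of s' v.
Hypothesis outside : forall v, (forall u, v != f u) ->
  place r v = place r' v /\ deco_of r v = deco_of r' v.

Lemma step_embedding : step s s' -> step r r'.
Proof.
case/stepP=> x [y [b [pxy bt w sE]]]; apply/stepP; exists (f x), (f y), (f b).
split.
- by rewrite !place_f !hE pxy addnS.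
- by move: bt; rewrite /between !f_incr.
- by move: w; rewrite /wall !place_f deco_f !hE !ltn_add2l.
have f_inj : injective f.
  move=> i j E; apply: val_inj.
  by case: (ltngtP i j) => //; rewrite -f_incr E ltnn.
apply: place_eq => v.
  rewrite place_swap.
  have [/existsP[u /eqP->]|/existsPn H] := boolP [exists u, v == f u].
    by rewrite -(inj_tperm _ _ _ f_inj) place_f' place_f sE place_swap.
  by rewrite tpermD 1?eq_sym ?H // (outside H).1.
rewrite deco_of_swap.
have [/existsP[u /eqP->]|/existsPn H] := boolP [exists u, v == f u].
  by rewrite deco_f' deco_f sE deco_of_swap.
by rewrite (outside H).2.
Qed.

End Embedding.

Section Glue.
Variables k l : nat.

(** The element of the convolution of t and t' that w produces. *)
Definition glue (t : dperm k) (t' : dperm l) (w : 'S_(k + l)) : dperm (k + l) :=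
  ((shift_concat t.1 t'.1 * w)%g, deco_concat t.2 t'.2).

Lemma glue_inj t t' : injective (glue t t').
Proof. by move=> w w' [/mulgI]. Qed.

Lemma place_glue_l t t' w v :
  place (glue t t' w) (w (lshift l v)) = lshift l (place t v).
Proof. by rewrite /place /= invMg permM permK shift_concatV shift_concat_lshift. Qed.

Lemma place_glue_r t t' w v :
  place (glue t t' w) (w (rshift k v)) = rshift k (place t' v).
Proof. by rewrite /place /= invMg permM permK shift_concatV shift_concat_rshift. Qed.

Lemma deco_of_glue_l t t' w v :
  deco_of (glue t t' w) (w (lshift l v)) = deco_of t v.
Proof. by rewrite /deco_of place_glue_l /= deco_concat_lshift. Qed.

Lemma deco_of_glue_r t t' w v :
  deco_of (glue t t' w) (w (rshift k v)) = deco_of t' v.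
Proof. by rewrite /deco_of place_glue_r /= deco_concat_rshift. Qed.

Lemma glue_step_l t1 t2 t' w :
  w \in grassmannian k l -> step t1 t2 -> step (glue t1 t' w) (glue t2 t' w).
Proof.
move=> /grassmannianP[w0 _].
apply: (@step_embedding _ _ 0 (fun v => w (lshift l v)) (@lshift k l)) => //.
- exact: increasing_mono w0.
- by move=> v; rewrite place_glue_l.
- by move=> v; rewrite place_glue_l.
- by move=> v; rewrite deco_of_glue_l.
- by move=> v; rewrite deco_of_glue_l.
move=> v H; rewrite -(permKV w v); case: (split_ordP ((w^-1)%g v)) => i E.
  by have := H i; rewrite -E permKV eqxx.
by rewrite E !place_glue_r !deco_of_glue_r.
Qed.

Lemma glue_step_r t t1 t2 w :
  w \in grassmannian k l -> step t1 t2 -> step (glue t t1 w) (glue t t2 w).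
Proof.
move=> /grassmannianP[_ wk].
apply: (@step_embedding _ _ k (fun v => w (rshift k v)) (@rshift k l)) => //.
- exact: increasing_mono wk.
- by move=> v; rewrite place_glue_r.
- by move=> v; rewrite place_glue_r.
- by move=> v; rewrite deco_of_glue_r.
- by move=> v; rewrite deco_of_glue_r.
move=> v H; rewrite -(permKV w v); case: (split_ordP ((w^-1)%g v)) => i E.
  by rewrite E !place_glue_l !deco_of_glue_l.
by have := H i; rewrite -E permKV eqxx.
Qed.

End Glue.

Import GRing.Theory.
Local Open Scope ring_scope.

(** * Free modules *)

Section FreeModuleTheory.
Variable K : fieldType.

HB.instance Definition _ (I J I' J' : choiceType)
    (f : {malg K[I]} -> {malg K[I']}) (g : {malg K[J]} -> {malg K[J']}) :=
  GRing.isLinear.Build K {malg K[(I * J)%type]} {malg K[(I' * J')%type]} *:%R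
    (tensor_map f g) (lin_ext_is_linear _).

Lemma lin_extU (I : choiceType) (W : lmodType K) (f : I -> W) k :
  lin_ext f << k >> = f k.
Proof.
by rewrite (lin_extEw f msuppU_le) big_seq_fset1 mcoeffUU scale1r.
Qed.

Lemma sum_msupp (I : choiceType) (x : {malg K[I]}) (h : I -> K) i :
  \sum_(k <- msupp x) x@_k * (h k *+ (k == i)) = x@_i * h i.
Proof.
have [ix|ix] := boolP (i \in msupp x).
  rewrite (bigD1_seq i) ?fset_uniq //= eqxx big1 ?addr0 // => k /negPf->.
  by rewrite mulr0.
rewrite (mcoeff_outdom ix) mul0r big_seq big1 // => k kx.
by case: eqP kx ix => [-> ->|_ _ _]; rewrite ?mulr0.
Qed.

Lemma mcoeff_lin_ext (I J : choiceType) (f : I -> {malg K[J]}) x j :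
  (lin_ext f x)@_j = \sum_(k <- msupp x) x@_k * (f k)@_j.
Proof.
by rewrite /lin_ext raddf_sum; apply: eq_bigr => k _; rewrite /= mcoeffZ.
Qed.

Lemma mcoeff_tensor (I J : choiceType) (x : {malg K[I]}) (y : {malg K[J]}) p :
  (tensor x y)@_p = x@_p.1 * y@_p.2.
Proof.
rewrite mcoeff_lin_ext -(sum_msupp x (fun=> y@_p.2)); apply: eq_bigr => i _.
rewrite mcoeff_lin_ext; congr (_ * _).
have [->|ip] := eqVneq i p.1.
  rewrite mulr1n -[RHS]mulr1 -(sum_msupp y (fun=> 1)); apply: eq_bigr => j _.
  by rewrite mcoeffU -pair_eqE /= eqxx.
by rewrite big1 // => j _; rewrite mcoeffU -pair_eqE /= (negPf ip) mulr0.
Qed.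

Lemma malg_basis (I : choiceType) (x : {malg K[I]}) :
  x = \sum_(k <- msupp x) x@_k *: << k >>.
Proof.
rewrite [LHS]monalgE; apply: eq_bigr => k _; apply/malgP => j.
by rewrite mcoeffZ !mcoeffU mulr_natr.
Qed.

Lemma linear_lin_ext (I : choiceType) (V W : lmodType K) (h : {linear V -> W})
  (f : I -> V) x : h (lin_ext f x) = lin_ext (h \o f) x.
Proof. by rewrite /lin_ext linear_sum; apply: eq_bigr => k _; rewrite linearZ. Qed.

Lemma mcoeff_linear (I J : choiceType)
    (f : {linear {malg K[I]} -> {malg K[J]}}) x j :
  (f x)@_j = \sum_(k <- msupp x) x@_k * (f << k >>)@_j.
Proof.
rewrite {1}[x]malg_basis linear_sum raddf_sum.
by apply: eq_bigr => k _; rewrite linearZ /= mcoeffZ.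
Qed.

Lemma tensor_mapE (I J I' J' : choiceType)
    (f : {linear {malg K[I]} -> {malg K[I']}})
    (g : {linear {malg K[J]} -> {malg K[J']}}) x y :
  tensor_map f g (tensor x y) = tensor (f x) (g y).
Proof.
rewrite {1}/tensor linear_lin_ext.
apply/malgP => p; rewrite mcoeff_lin_ext mcoeff_tensor.
rewrite mcoeff_linear mulr_suml; apply: eq_bigr => i _.
rewrite -mulrA; congr (_ * _).
rewrite /= linear_lin_ext mcoeff_lin_ext [X in _ * X]mcoeff_linear mulr_sumr.
apply: eq_bigr => j _.
by rewrite /= /tensor_map lin_extU mcoeff_tensor mulrCA.
Qed.

Section Span.
Variables (V W : lmodType K) (P : V -> Prop).

Lemma span0 : Defs.span P 0.
Proof. by exists [::]; split; [|rewrite big_nil]. Qed.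

Lemma spanD x y : Defs.span P x -> Defs.span P y -> Defs.span P (x + y).
Proof.
move=> [s [sP ->]] [s' [s'P ->]]; exists (s ++ s'); rewrite big_cat; split=> //.
by move=> p; rewrite mem_cat => /orP[/sP|/s'P].
Qed.

Lemma spanZ c x : Defs.span P x -> Defs.span P (c *: x).
Proof.
move=> [s [sP ->]]; exists [seq (c * p.1, p.2) | p <- s]; split.
  by move=> _ /mapP[p /sP ? ->].
by rewrite big_map scaler_sumr; apply: eq_bigr => p _; rewrite scalerA.
Qed.

Lemma span_gen x : P x -> Defs.span P x.
Proof.
move=> Px; exists [:: (1, x)]; rewrite big_seq1 scale1r; split=> // p.
by rewrite inE => /eqP->.
Qed.

Lemma span_sum (I : eqType) (r : seq I) (Q : pred I) (F : I -> V) :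
  (forall i, i \in r -> Q i -> Defs.span P (F i)) ->
  Defs.span P (\sum_(i <- r | Q i) F i).
Proof.
move=> H; rewrite big_seq_cond; apply: big_ind => [||i /andP[]].
- exact: span0.
- exact: spanD.
- exact: H.
Qed.

End Span.

(** The map [rho] picks a representative in each class of an equivalence on the
    basis, and [cls] is the sum of a class. *)
Section Classes.
Variables (I : choiceType) (rho : I -> I) (cls : I -> {malg K[I]}).
Hypothesis mcoeff_cls :
  forall r t, rho r = r -> (cls r)@_t = (rho t == r)%:R.
Hypothesis rhoK : forall t, rho (rho t) = rho t.

Lemma class_decomposition x : (forall t, x@_t = x@_(rho t)) ->
  x = \sum_(r <- msupp x | rho r == r) x@_r *: cls r.
Proof.
move=> xr; apply/malgP => t; rewrite raddf_sum /= xr.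
rewrite -[LHS]mulr1 -(sum_msupp x (fun=> 1)) big_mkcond [RHS]big_mkcond /=.
apply: eq_bigr => r _; rewrite mcoeffZ.
have [/eqP E|ne] := ifP; first by rewrite mcoeff_cls // eq_sym.
have [rE|_] := eqVneq r (rho t); last by rewrite mulr0.
by rewrite rE rhoK eqxx in ne.
Qed.

End Classes.
End FreeModuleTheory.

(** * Coefficients of products and coproducts *)

Definition seg (s : dword) a l : dword := DWord (segment (tagged s) a l).
Definition blk (s : dword) a l : dword := DWord (block (tagged s) a l).

Lemma seg_seg s a l b k : (b + k <= l)%N -> seg (seg s a l) b k = seg s (a + b) k.
Proof. by move=> le; rewrite /seg /= segment_segment. Qed.

Lemma blk_blk s a l b k : (b + k <= l)%N -> blk (blk s a l) b k = blk s (a + b) k.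
Proof. by move=> le; rewrite /blk /= block_block. Qed.

Lemma seg_full s : seg s 0 (tag s) = s.
Proof. by case: s => n s; rewrite /seg segment_full. Qed.

Lemma blk_full s : blk s 0 (tag s) = s.
Proof. by case: s => n s; rewrite /blk block_full. Qed.

(** The term of the coproduct of s whose first factor has size k. *)
Definition cut (s : dword) k : dword * dword := (seg s 0 k, seg s k (tag s - k)).
(** The only pair with a first word of size k whose product contains s. *)
Definition vcut (s : dword) k : dword * dword := (blk s 0 k, blk s k (tag s - k)).

Lemma DWord_eq n (t u : dperm n) : (DWord t == DWord u) = (t == u).
Proof. by rewrite /DWord eq_Tagged. Qed.

Lemma DWord_tag n (t : dperm n) s : DWord t == s -> n = tag s.
Proof. by move/eqP <-. Qed.

(** In the coproduct the size of r is a sum while that of u is a variable, so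
    the comparison takes place in [dword]. *)
Lemma exists_in_convolution k l m (u : dperm m) (t : dperm k) (t' : dperm l) :
  (k + l)%N = m ->
  [exists r in convolution t t', DWord r == DWord u]
  = (segment u 0 k == t) && (segment u k l == t').
Proof.
move=> e; subst m; rewrite -in_convolution.
apply/existsP/idP => [[r /andP[rc]]|uc]; last by exists u; rewrite uc eqxx.
by rewrite DWord_eq => /eqP<-.
Qed.

Section Products.
Variable K : fieldType.
Local Notation V := {malg K[dword]}.
Local Notation V2 := {malg K[(dword * dword)%type]}.

Lemma sum_DWord_eq n (A : {set dperm n}) (s : dword) :
  \sum_(r in A) (DWord r == s)%:R
  = [exists r in A, DWord r == s]%:R :> K.
Proof.
have [/existsP[r /andP[rA /eqP rs]]|/existsPn H] :=
  boolP [exists r in A, DWord r == s].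
  rewrite (bigD1 r) //= rs eqxx big1 ?addr0 // => r' /andP[_ ne].
  by rewrite -rs DWord_eq (negPf ne).
by rewrite big1 // => r rA; have := H r; rewrite rA /= => /negPf->.
Qed.

Lemma cut_convolution_sum (p q s : dword) k : (k <= tag s)%N ->
  (cut s k == (p, q))%:R =
  (tag p == k)%:R * \sum_(r in convolution (tagged p) (tagged q)) (DWord r == s)%:R
  :> K.
Proof.
case: p q s => [i t] [j t'] [m u] /= km; rewrite sum_DWord_eq -pair_eqE /=.
have [ik|ik] := eqVneq i k; last first.
  by rewrite mul0r; case: eqP => //= E; case/eqP: ik; have := congr1 tag E.
subst i; rewrite mul1r; congr (nat_of_bool _)%:R.
have [e|ne] := eqVneq (k + j)%N m.
  rewrite -[existT _ m u]/(DWord u) (exists_in_convolution u t t' e) /seg /=.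
  subst m; rewrite addKn.
  by rewrite -[existT _ k t]/(DWord t) -[existT _ j t']/(DWord t') !DWord_eq.
symmetry; apply/existsP/andP => [[r /andP[_ /DWord_tag/= e]]|[_ /eqP E]].
  by rewrite e eqxx in ne.
by have /= e := congr1 tag E; rewrite -e subnKC // eqxx in ne.
Qed.

Lemma tensorU (I J : choiceType) (i : I) (j : J) :
  tensor << i >> << j >> = << (i, j) >> :> {malg K[(I * J)%type]}.
Proof. by rewrite /tensor !lin_extU. Qed.

Lemma fq_comulU (s : dword) :
  fq_comul (F_ K s) = \sum_(k < (tag s).+1) << cut s k >> :> V2.
Proof.
rewrite /fq_comul /F_ lin_extU; apply: eq_bigr => k _.
case: s k => m u /= k.
have e : (k + (m - k))%N = m by rewrite subnKC // -ltnS.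
rewrite (bigD1 (segment u 0 k)) //= [X in _ + X]big1 ?addr0 => [|t /negPf nt].
  rewrite (eq_bigl (pred1 (segment u k (m - k)))) ?big_pred1_eq ?tensorU //.
  move=> t'; rewrite -[existT _ m u]/(DWord u) (exists_in_convolution u _ t' e).
  by rewrite eqxx /= eq_sym.
apply: big1 => t'.
by rewrite -[existT _ m u]/(DWord u) (exists_in_convolution u _ t' e) eq_sym nt.
Qed.

(** The double sum over the cuts of the support of x is rearranged: the words
    that cut into p and q are those of the convolution. *)
Lemma mcoeff_comul (x : V) (p q : dword) :
  (fq_comul x : V2)@_(p, q)
  = \sum_(r in convolution (tagged p) (tagged q)) x@_(DWord r).
Proof.
rewrite mcoeff_lin_ext.
transitivity (\sum_(s <- msupp x) \sum_(r in convolution (tagged p) (tagged q))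
    x@_s * (1 *+ (s == DWord r))).
  apply: eq_bigr => s _; rewrite -mulr_sumr; congr (_ * _).
  have := fq_comulU s; rewrite /fq_comul /F_ lin_extU => ->.
  under [RHS]eq_bigr do rewrite eq_sym.
  rewrite raddf_sum /=.
  under eq_bigr => k _ do rewrite mcoeffU cut_convolution_sum -1?ltnS //.
  rewrite -mulr_suml.
  have [le|gt] := leqP (tag p) (tag s).
    rewrite (bigD1 (inord (tag p))) //= inordK // eqxx big1 ?addr0 ?mul1r //.
    move=> k ne; case: eqP => // E; case/eqP: ne; apply: val_inj.
    by rewrite /= inordK // E.
  have c0 (r : dperm (tag p + tag q)) : (DWord r == s) = false.
    apply/eqP => E.
    by move: gt; rewrite -E /= ltnNge leq_addr.
  rewrite [X in _ * X]big1 => [|r _]; last by rewrite c0.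
  by rewrite mulr0 big1 // => r _; rewrite c0.
rewrite exchange_big /=; apply: eq_bigr => r _.
by rewrite (sum_msupp x (fun=> 1)) mulr1.
Qed.

Lemma vcut_shuffle_sum (p : dword * dword) (s : dword) :
  \sum_(r in shifted_shuffle (tagged p.1) (tagged p.2)) (DWord r == s)%:R
  = \sum_(k < (tag s).+1) (p == vcut s k)%:R :> K.
Proof.
rewrite sum_DWord_eq; case: p s => -[i t] [j t'] [m u] /=.
have [e|ne] := eqVneq (i + j)%N m.
  subst m; have lt : (i < (i + j).+1)%N by rewrite ltnS leq_addr.
  rewrite (bigD1 (Ordinal lt)) //= big1 ?addr0 => [|k ne].
    congr (nat_of_bool _)%:R; rewrite -pair_eqE /blk /= addKn.
    rewrite -[existT _ i t]/(DWord t) -[existT _ j t']/(DWord t') !DWord_eq.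
    rewrite eq_sym (eq_sym t') -in_shuffle.
    apply/existsP/idP => [[r /andP[rc]]|uc]; last by exists u; rewrite uc eqxx.
    by rewrite -[existT _ _ u]/(DWord u) DWord_eq => /eqP<-.
  case: eqP => // E; case/eqP: ne; apply: val_inj => /=.
  by have := congr1 (fun z => tag z.1) E.
have -> : [exists r in shifted_shuffle t t', DWord r == existT _ m u] = false.
  apply/existsP => -[r /andP[_ /DWord_tag/= e]].
  by rewrite e eqxx in ne.
rewrite big1 // => k _; case: eqP => // E.
have /= e1 := congr1 (fun z => tag z.1) E.
have /= e2 := congr1 (fun z => tag z.2) E.
by rewrite e1 e2 subnKC ?eqxx // -ltnS in ne.
Qed.

Lemma mcoeff_mulT (z : V2) (s : dword) :
  (fq_mulT z : V)@_s = \sum_(k < (tag s).+1) z@_(vcut s k).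
Proof.
rewrite mcoeff_lin_ext.
transitivity (\sum_(p <- msupp z) \sum_(k < (tag s).+1)
    z@_p * (1 *+ (p == vcut s k))).
  apply: eq_bigr => p _; rewrite -mulr_sumr; congr (_ * _).
  rewrite -vcut_shuffle_sum raddf_sum; apply: eq_bigr => r _.
  by rewrite /= mcoeffU.
rewrite exchange_big /=; apply: eq_bigr => k _.
by rewrite (sum_msupp z (fun=> 1)) mulr1.
Qed.

Lemma mcoeff_mul (x y : V) (s : dword) :
  (fq_mul x y : V)@_s
  = \sum_(k < (tag s).+1) x@_(blk s 0 k) * y@_(blk s k (tag s - k)).
Proof.
by rewrite mcoeff_mulT; apply: eq_bigr => k _; rewrite mcoeff_tensor.
Qed.

End Products.

(** * Associativity and the antipode *)

(** Both associativity and coassociativity count pairs k <= l of cutting places: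
    either l first and then k, or k first and then the distance from k to l. *)
Lemma triangle_sum (V : zmodType) m (G : nat -> nat -> V) :
  \sum_(l < m.+1) \sum_(k < l.+1) G k l
  = \sum_(k < m.+1) \sum_(j < (m - k).+1) G k (k + j)%N.
Proof.
elim: m => [|m IH]; first by rewrite !big_ord1.
rewrite [LHS]big_ord_recr [RHS]big_ord_recr /= IH [X in _ + X = _]big_ord_recr /=.
rewrite subnn big_ord1 addn0 addrA -big_split /=; congr (_ + _).
apply: eq_bigr => k _; rewrite subSn -1?ltnS // [RHS]big_ord_recr /=.
by rewrite addnS subnKC // -ltnS.
Qed.

Section Algebra.
Variable K : fieldType.
Local Notation V := {malg K[dword]}.
Local Notation V2 := {malg K[(dword * dword)%type]}.
Local Notation F s := (F_ K s : V).
Local Notation mul := (@fq_mul K : V -> V -> V).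
Local Notation one := (fq_one K : V).

Lemma fq_mul_suml (I : Type) (r : seq I) (P : pred I) (f : I -> V) y :
  mul (\sum_(i <- r | P i) f i) y = \sum_(i <- r | P i) mul (f i) y.
Proof.
apply/malgP => s; rewrite mcoeff_mul raddf_sum.
under [RHS]eq_bigr do rewrite /= mcoeff_mul.
rewrite exchange_big; apply: eq_bigr => k _.
by rewrite raddf_sum mulr_suml.
Qed.

Lemma fq_mul_sumr (I : Type) (r : seq I) (P : pred I) (f : I -> V) x :
  mul x (\sum_(i <- r | P i) f i) = \sum_(i <- r | P i) mul x (f i).
Proof.
apply/malgP => s; rewrite mcoeff_mul raddf_sum.
under [RHS]eq_bigr do rewrite /= mcoeff_mul.
rewrite exchange_big; apply: eq_bigr => k _.
by rewrite raddf_sum mulr_sumr.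
Qed.

Lemma fq_mul0r y : mul 0 y = 0.
Proof.
apply/malgP => s; rewrite mcoeff_mul big1 ?mcoeff0 // => k _.
by rewrite mcoeff0 mul0r.
Qed.

Lemma fq_mulr0 x : mul x 0 = 0.
Proof.
apply/malgP => s; rewrite mcoeff_mul big1 ?mcoeff0 // => k _.
by rewrite mcoeff0 mulr0.
Qed.

Lemma fq_mulA x y z : mul x (mul y z) = mul (mul x y) z.
Proof.
apply/malgP => s; rewrite [LHS]mcoeff_mul [RHS]mcoeff_mul.
pose G k l := x@_(blk s 0 k) * y@_(blk s k (l - k)) * z@_(blk s l (tag s - l)).
transitivity (\sum_(l < (tag s).+1) \sum_(k < l.+1) G k l); last first.
  apply: eq_bigr => l _; rewrite mcoeff_mul mulr_suml; apply: eq_bigr => k _.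
  have kl : (k <= l)%N by rewrite -ltnS.
  by rewrite !blk_blk ?add0n ?subnKC.
rewrite triangle_sum; apply: eq_bigr => k _; rewrite mcoeff_mul mulr_sumr.
apply: eq_bigr => j _; rewrite mulrA /G addKn.
have jk : (j <= tag s - k)%N by rewrite -ltnS.
by rewrite !blk_blk ?subnKC // addn0 subnDA.
Qed.

Lemma F_size0 s : tag s = 0%N -> F s = one.
Proof.
case: s => n t /= n0; subst n; rewrite /fq_one; congr F_; congr DWord.
by apply: dperm_order_eq => -[].
Qed.

Lemma mcoeff_one s : one@_s = (tag s == 0%N)%:R.
Proof.
have [s0|s0] := eqVneq (tag s) 0%N.
  by rewrite -(F_size0 s0) mcoeffUU.
rewrite /fq_one mcoeffU (_ : (_ == s) = false) //.
by apply: contraNF s0 => /eqP <-.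
Qed.

Lemma fq_mul1r x : mul one x = x.
Proof.
apply/malgP => s; rewrite mcoeff_mul big_ord_recl mcoeff_one mul1r subn0 blk_full.
by rewrite big1 ?addr0 // => k _; rewrite mcoeff_one mul0r.
Qed.

Lemma fq_mulr1 x : mul x one = x.
Proof.
apply/malgP => s; rewrite mcoeff_mul big_ord_recr /= subnn mcoeff_one mulr1.
rewrite blk_full big1 ?add0r // => k _; rewrite mcoeff_one /=.
by rewrite subn_eq0 leqNgt ltn_ord mulr0.
Qed.

(** Solving the antipode equation for its top term gives a recursion on the
    size; the argument n is a bound on the depth. *)
Fixpoint left_antipode_rec n (s : dword) : V :=
  if n is n'.+1 then
    if tag s == 0%N then F s
    else - \sum_(k < tag s)
             mul (left_antipode_rec n' (seg s 0 k)) (F (seg s k (tag s - k)))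
  else F s.

Lemma left_antipode_recS n s : left_antipode_rec n.+1 s =
  if tag s == 0%N then F s
  else - \sum_(k < tag s)
           mul (left_antipode_rec n (seg s 0 k)) (F (seg s k (tag s - k))).
Proof. by []. Qed.

Definition left_antipode s := left_antipode_rec (tag s) s.

Lemma left_antipode_fuel n n' s : (tag s <= n)%N -> (tag s <= n')%N ->
  left_antipode_rec n s = left_antipode_rec n' s.
Proof.
have rec0 m u : tag u = 0%N -> left_antipode_rec m u = F u.
  by case: m => //= m ->.
elim: n n' s => [|n IH] [|n'] s le le'.
- by [].
- by rewrite !rec0 //; apply/eqP; rewrite -leqn0.
- by rewrite !rec0 //; apply/eqP; rewrite -leqn0.
rewrite left_antipode_recS [RHS]left_antipode_recS.
case: (tag s == 0%N); first by [].
apply: (congr1 -%R).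
apply: eq_bigr => k _.
have lt := ltn_ord k.
by rewrite (IH n'); [|exact: leq_trans lt le|exact: leq_trans lt le'].
Qed.

Lemma left_antipodeE s : tag s != 0%N ->
  left_antipode s = - \sum_(k < tag s)
    mul (left_antipode (seg s 0 k)) (F (seg s k (tag s - k))).
Proof.
rewrite /left_antipode; case E : (tag s) => [|n] // _ /=; rewrite E /=.
apply: (congr1 -%R).
apply: eq_bigr => k _.
by rewrite (@left_antipode_fuel n k) //= -ltnS.
Qed.

Lemma left_antipode0 s : tag s = 0%N -> left_antipode s = one.
Proof. by move=> s0; rewrite /left_antipode s0 /= F_size0. Qed.

Lemma left_antipodeP s :
  \sum_(k < (tag s).+1) mul (left_antipode (seg s 0 k)) (F (seg s k (tag s - k)))
  = (tag s == 0%N)%:R *: one.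
Proof.
rewrite big_ord_recr /= subnn seg_full [F (seg s _ 0)]F_size0 // fq_mulr1.
have [s0|s0] := eqVneq (tag s) 0%N.
  rewrite scale1r left_antipode0 // big1 ?add0r // => -[k lt] _ /=.
  by move: lt; rewrite {1}s0.
by rewrite scale0r [left_antipode s]left_antipodeE // addrN.
Qed.

Fixpoint right_antipode_rec n (s : dword) : V :=
  if n is n'.+1 then
    if tag s == 0%N then F s
    else - \sum_(k < tag s)
             mul (F (seg s 0 k.+1)) (right_antipode_rec n' (seg s k.+1 (tag s - k.+1)))
  else F s.

Lemma right_antipode_recS n s : right_antipode_rec n.+1 s =
  if tag s == 0%N then F s
  else - \sum_(k < tag s)
           mul (F (seg s 0 k.+1)) (right_antipode_rec n (seg s k.+1 (tag s - k.+1))).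
Proof. by []. Qed.

Definition right_antipode s := right_antipode_rec (tag s) s.

Lemma right_antipode_fuel n n' s : (tag s <= n)%N -> (tag s <= n')%N ->
  right_antipode_rec n s = right_antipode_rec n' s.
Proof.
have rec0 m u : tag u = 0%N -> right_antipode_rec m u = F u.
  by case: m => //= m ->.
elim: n n' s => [|n IH] [|n'] s le le'.
- by [].
- by rewrite !rec0 //; apply/eqP; rewrite -leqn0.
- by rewrite !rec0 //; apply/eqP; rewrite -leqn0.
rewrite right_antipode_recS [RHS]right_antipode_recS.
case: (tag s == 0%N); first by [].
apply: (congr1 -%R).
apply: eq_bigr => k _.
have lt := ltn_ord k.
rewrite (IH n') //=; first by move: lt le; clear; lia.
by move: lt le'; clear; lia.
Qed.

Lemma right_antipodeE s : tag s != 0%N ->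
  right_antipode s = - \sum_(k < tag s)
    mul (F (seg s 0 k.+1)) (right_antipode (seg s k.+1 (tag s - k.+1))).
Proof.
rewrite /right_antipode; case E : (tag s) => [|n] // _ /=; rewrite E /=.
apply: (congr1 -%R).
apply: eq_bigr => k _.
by rewrite (@right_antipode_fuel n (n.+1 - k.+1)) //= subSS leq_subr.
Qed.

Lemma right_antipode0 s : tag s = 0%N -> right_antipode s = one.
Proof. by move=> s0; rewrite /right_antipode s0 /= F_size0. Qed.

Lemma right_antipodeP s :
  \sum_(k < (tag s).+1) mul (F (seg s 0 k)) (right_antipode (seg s k (tag s - k)))
  = (tag s == 0%N)%:R *: one.
Proof.
rewrite big_ord_recl /= subn0 seg_full [F (seg s _ 0)]F_size0 //.
rewrite [X in X + _ = _](fq_mul1r (right_antipode s)).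
have [s0|s0] := eqVneq (tag s) 0%N.
  rewrite scale1r right_antipode0 // big1 ?addr0 // => -[k lt] _ /=.
  by move: lt; rewrite {1}s0.
by rewrite scale0r [right_antipode s]right_antipodeE // addNr.
Qed.

(** Cutting s in three pieces, mapped by the left antipode, the identity and the
    right antipode, gives a sum that collapses in two ways: the first two pieces
    combine to the counit, or the last two do. *)
Lemma left_right_antipode s : left_antipode s = right_antipode s.
Proof.
pose G k l := mul (left_antipode (seg s 0 k))
  (mul (F (seg s k (l - k))) (right_antipode (seg s l (tag s - l)))).
transitivity (\sum_(l < (tag s).+1) \sum_(k < l.+1) G k l).
  rewrite triangle_sum big_ord_recr /= big1 ?add0r => [|k _].
    rewrite subnn big_ord1 /G addn0 !subnn !seg_full.
    by rewrite [F _]F_size0 // fq_mul1r right_antipode0 // fq_mulr1.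
  have := right_antipodeP (seg s k (tag s - k)).
  rewrite /= subn_eq0 leqNgt ltn_ord scale0r => E.
  rewrite /G -fq_mul_sumr -[RHS](fq_mulr0 (left_antipode (seg s 0 k))).
  congr mul; rewrite -[RHS]E; apply: eq_bigr => j _.
  have jk : (j <= tag s - k)%N by rewrite -ltnS.
  rewrite addKn (@seg_seg s k (tag s - k) 0 j jk) addn0.
  rewrite (@seg_seg s k (tag s - k) j (tag s - k - j)); last by rewrite subnKC.
  by rewrite subnDA.
rewrite big_ord_recl big_ord1 /= /G !subn0 !seg_full.
rewrite left_antipode0 // [F (seg s 0 0)]F_size0 //.
rewrite [X in X + _ = _](fq_mul1r _) [X in X + _ = _](fq_mul1r _).
rewrite big1 ?addr0 // => l _.
have := left_antipodeP (seg s 0 (lift ord0 l)).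
rewrite /= scale0r => E.
under eq_bigr do rewrite fq_mulA.
rewrite -fq_mul_suml.
rewrite -[RHS](fq_mul0r (right_antipode (seg s l.+1 (tag s - l.+1)))).
congr mul; rewrite -[RHS]E; apply: eq_bigr => k _.
have kl : (k <= l.+1)%N by rewrite -ltnS.
rewrite (@seg_seg s 0 l.+1 0 k kl) add0n.
by rewrite (@seg_seg s 0 l.+1 k (l.+1 - k)) ?subnKC.
Qed.

Definition antipode : V -> V := lin_ext left_antipode.

HB.instance Definition _ := GRing.isLinear.Build K V V *:%R antipode
  (lin_ext_is_linear left_antipode).
HB.instance Definition _ := GRing.isLinear.Build K V2 V *:%R (@fq_mulT K)
  (lin_ext_is_linear _).

Lemma mulT_tensor_map_comul (s : dword) (A B : {linear V -> V}) :
  fq_mulT (tensor_map A B (fq_comul (F s) : V2) : V2)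
  = \sum_(k < (tag s).+1) mul (A (F (seg s 0 k))) (B (F (seg s k (tag s - k)))) :> V.
Proof.
rewrite fq_comulU (linear_sum (tensor_map A B)) (linear_sum (@fq_mulT K)).
by apply: eq_bigr => k _; rewrite /= /tensor_map lin_extU.
Qed.

(** The antipode equations are linear, so they are checked on the basis. *)
Lemma map_convolution_unit (A B : {linear V -> V}) :
  (forall s, \sum_(k < (tag s).+1)
       mul (A (F (seg s 0 k))) (B (F (seg s k (tag s - k))))
     = (tag s == 0%N)%:R *: one) ->
  forall x : V, fq_mulT (tensor_map A B (fq_comul x : V2) : V2)
     = fq_counit x *: one :> V.
Proof.
move=> H x; rewrite {1}/fq_comul (linear_lin_ext (tensor_map A B)).
rewrite (linear_lin_ext (@fq_mulT K)).
rewrite /fq_counit /lin_ext scaler_suml; apply: eq_bigr => s _.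
rewrite -scalerA; congr (_ *: _) => /=.
have := mulT_tensor_map_comul s A B; rewrite {1}/fq_comul /F_ lin_extU => ->.
by rewrite H; case: ifP.
Qed.

Lemma antipodeP : is_antipode (antipode : {linear FQSym K -> FQSym K}).
Proof.
move=> x; split.
  apply: (map_convolution_unit (A := antipode) (B := idfun)) => s.
  rewrite -left_antipodeP; apply: eq_bigr => k _.
  by rewrite /= /antipode lin_extU.
apply: (map_convolution_unit (A := idfun) (B := antipode)) => s.
rewrite -right_antipodeP; apply: eq_bigr => k _.
by rewrite /= /antipode lin_extU left_right_antipode.
Qed.

End Algebra.

(** * The subspace of permutrees *)

Definition class_rep (s : dword) : dword :=
  DWord (fingraph.root (@step (tag s)) (tagged s)).

Lemma class_repK s : class_rep (class_rep s) = class_rep s.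
Proof.
by rewrite /class_rep /= (root_root (@connect_step_sym _)).
Qed.

Section Main.
Variable K : fieldType.
Local Notation V := {malg K[dword]}.
Local Notation V2 := {malg K[(dword * dword)%type]}.

Definition class_sum (s : dword) : V :=
  \sum_(t : dperm (tag s) | connect (@step _) (tagged s) t) F_ K (DWord t).

(** Applied to the coefficients of an element, this is the criterion for being
    in [PT]. It is stated for functions because it is also applied to the
    coefficients of a tensor in one argument. *)
Definition step_invariant (f : dword -> K) : Prop :=
  forall n (s t : dperm n), step s t -> f (DWord s) = f (DWord t).

Lemma step_invariant_rep f s : step_invariant f -> f s = f (class_rep s).
Proof.
move=> fi; case: s => n s; rewrite /class_rep /=.
have /connectP[p sp ->] := connect_root (@step n) s.
elim: p s sp => //= u p IH s /andP[su pu].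
by rewrite -[existT _ n s]/(DWord s) (fi _ _ _ su) IH.
Qed.

Lemma mcoeff_F_sum n (A : {set dperm n}) (s : dword) :
  (\sum_(t in A) F_ K (DWord t) : V)@_s = [exists t in A, DWord t == s]%:R.
Proof.
rewrite -sum_DWord_eq raddf_sum; apply: eq_bigr => t _.
by rewrite /F_ /= mcoeffU.
Qed.

Lemma mcoeff_F_sum_DWord n (A : {set dperm n}) (s : dperm n) :
  (\sum_(t in A) F_ K (DWord t) : V)@_(DWord s) = (s \in A)%:R.
Proof.
rewrite mcoeff_F_sum; congr (nat_of_bool _)%:R.
apply/existsP/idP => [[t /andP[tA]]|sA]; last by exists s; rewrite sA eqxx.
by rewrite DWord_eq => /eqP<-.
Qed.

Lemma mcoeff_F_sum0 n m (A : {set dperm n}) (s : dperm m) : n != m ->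
  (\sum_(t in A) F_ K (DWord t) : V)@_(DWord s) = 0.
Proof.
move=> nm; rewrite mcoeff_F_sum; case: existsP => // -[t /andP[_ /DWord_tag e]].
by rewrite e eqxx in nm.
Qed.

Lemma class_sumE s :
  class_sum s = \sum_(t in [set t | connect (@step _) (tagged s) t]) F_ K (DWord t).
Proof. by apply: eq_bigl => t; rewrite inE. Qed.

Lemma mcoeff_class_sum r t : class_rep r = r ->
  (class_sum r)@_t = (class_rep t == r)%:R.
Proof.
rewrite class_sumE; case: r t => [n r] [m t] rr.
have [e|ne] := eqVneq n m; last first.
  rewrite mcoeff_F_sum0 //; case: eqP => // /(congr1 tag)/= e.
  by rewrite e eqxx in ne.
subst m; rewrite mcoeff_F_sum_DWord inE /= -[existT _ n r]/(DWord r) DWord_eq.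
have := rr; rewrite /class_rep /= => /eqP.
rewrite -[existT _ n r]/(DWord r) DWord_eq /= => /eqP rE.
by rewrite -(root_connect (@connect_step_sym n)) rE eq_sym.
Qed.

Lemma P_step_invariant n (T : permutree n) :
  step_invariant (fun s => (P_ K T : V)@_s).
Proof.
move=> m s t st; rewrite /P_.
have [e|ne] := eqVneq n m; last by rewrite !mcoeff_F_sum0.
subst m; rewrite !mcoeff_F_sum_DWord; congr (nat_of_bool _)%:R.
by apply/idP/idP; apply: step_linext => //; rewrite step_sym.
Qed.

Lemma linext_class n (T : permutree n) (s t : dperm n) :
  s \in linear_extensions T ->
  (t \in linear_extensions T) = connect (@step n) s t.
Proof.
move=> sT; apply/idP/idP => [tT|/connectP[p + ->]].
  exact: linext_connect sT tT.
elim: p s sT => //= u p IH s sT /andP[su pu].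
exact: IH (step_linext su sT) pu.
Qed.

(** The class of s is the set of linear extensions of any permutree that s
    extends. *)
Lemma class_sum_permutree s : exists T : permutree (tag s), class_sum s = P_ K T.
Proof.
case: s => n s; have [T sT] := exists_permutree s; exists T.
by apply: eq_bigl => t; rewrite (linext_class _ sT).
Qed.

Lemma PT_P n (T : permutree n) : PT (P_ K T).
Proof. by apply: span_gen; exists n, T. Qed.

Lemma PT_class_sum s : PT (class_sum s : FQSym K).
Proof. by have [T ->] := class_sum_permutree s; apply: PT_P. Qed.

Lemma PT_invariant (x : V) : PT (x : FQSym K) -> step_invariant (fun s => x@_s).
Proof.
move=> [c [cP ->]] n s t st; rewrite !raddf_sum; apply: eq_big_seq => p /cP.
move=> [m [T E]]; rewrite /= !mcoeffZ E; congr (_ * _).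
exact: P_step_invariant.
Qed.

Lemma invariant_PT (x : V) : step_invariant (fun s => x@_s) -> PT (x : FQSym K).
Proof.
move=> xi; rewrite (class_decomposition mcoeff_class_sum class_repK (x := x)).
  by apply: span_sum => r _ _; apply/spanZ/PT_class_sum.
by move=> t; apply: (step_invariant_rep t xi).
Qed.

Lemma bi_invariant_decomposition (z : V2) :
  (forall q, step_invariant (fun p => z@_(p, q))) ->
  (forall p, step_invariant (fun q => z@_(p, q))) ->
  z = \sum_(r <- msupp z | (class_rep r.1, class_rep r.2) == r)
        z@_r *: tensor (class_sum r.1) (class_sum r.2).
Proof.
move=> zl zr.
apply: (class_decomposition (rho := fun r => (class_rep r.1, class_rep r.2))).
- move=> [r1 r2] [t1 t2] [e1 e2].
  by rewrite mcoeff_tensor /= !mcoeff_class_sum // -natrM mulnb -pair_eqE.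
- by move=> t; rewrite /= !class_repK.
- move=> [p q] /=.
  rewrite (step_invariant_rep p (zl q)).
  exact: (step_invariant_rep q (zr (class_rep p))).
Qed.

Lemma block_invariant f n (s t : dperm n) a l :
  step_invariant f -> step s t -> (a + l <= n)%N ->
  f (DWord (block s a l)) = f (DWord (block t a l)).
Proof. by move=> fi st le; case: (block_step le st) => [->|/fi]. Qed.

Lemma PT_mul (x y : V) : PT (x : FQSym K) -> PT (y : FQSym K) -> PT (fq_mul x y).
Proof.
move=> /PT_invariant xi /PT_invariant yi; apply: invariant_PT => n s t st.
rewrite [LHS]mcoeff_mul [RHS]mcoeff_mul; apply: eq_bigr => k _.
have kn : (k <= n)%N by rewrite -ltnS.
congr (_ * _); first exact: (block_invariant xi st).
by apply: (block_invariant yi st); rewrite /= subnKC.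
Qed.

Lemma convolution_glue (f : dword -> K) k l (t : dperm k) (t' : dperm l) :
  \sum_(r in convolution t t') f (DWord r)
  = \sum_(w in grassmannian k l) f (DWord (glue t t' w)).
Proof. by rewrite big_imset // => w w' _ _; apply: glue_inj. Qed.

Lemma convolution_invariant_l (f : dword -> K) (q : dword) : step_invariant f ->
  step_invariant
    (fun p => \sum_(r in convolution (tagged p) (tagged q)) f (DWord r)).
Proof.
move=> fi n s t st; rewrite !convolution_glue; apply: eq_bigr => w wg.
exact/fi/glue_step_l.
Qed.

Lemma convolution_invariant_r (f : dword -> K) (p : dword) : step_invariant f ->
  step_invariant
    (fun q => \sum_(r in convolution (tagged p) (tagged q)) f (DWord r)).
Proof.
move=> fi n s t st; rewrite !convolution_glue; apply: eq_bigr => w wg.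
exact/fi/glue_step_r.
Qed.

Lemma PT_comul (x : V) : PT (x : FQSym K) -> tensor_square (@PT K) (fq_comul x).
Proof.
move=> /PT_invariant xi; rewrite (bi_invariant_decomposition (z := fq_comul x)).
- apply: span_sum => r _ _; apply/spanZ/span_gen.
  by exists (class_sum r.1), (class_sum r.2); split=> //; apply: PT_class_sum.
- move=> q n s t st; rewrite !mcoeff_comul.
  exact: (convolution_invariant_l q xi st).
- move=> p n s t st; rewrite !mcoeff_comul.
  exact: (convolution_invariant_r p xi st).
Qed.

Lemma PT_one : PT (fq_one K).
Proof.
apply: invariant_PT => n s t /stepP[x _]; rewrite !mcoeff_one /=.
by case: n x s t => [[]|].
Qed.

(** The part of the coproduct whose first factor has size k, for x homogeneous
    of size at least k. *)
Definition cut_part k (x : V) : V2 := lin_ext (fun s => << cut s k >>) x.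

Lemma mcoeff_cut_part n k (x : V) p q : (k <= n)%N ->
  (forall s, s \in msupp x -> tag s = n) ->
  (cut_part k x)@_(p, q) = (tag p == k)%:R * (fq_comul x : V2)@_(p, q).
Proof.
move=> kn xn; rewrite mcoeff_comul mcoeff_lin_ext mulr_sumr.
transitivity (\sum_(s <- msupp x) \sum_(r in convolution (tagged p) (tagged q))
    x@_s * ((tag p == k)%:R *+ (s == DWord r))).
  apply: eq_big_seq => s /xn sn; rewrite mcoeffU cut_convolution_sum ?sn //.
  rewrite -[RHS]mulr_sumr; congr (_ * _); rewrite mulr_sumr; apply: eq_bigr => r _.
  by rewrite [s == _]eq_sym mulr_natr.
rewrite exchange_big /=; apply: eq_bigr => r _.
by rewrite (sum_msupp x (fun=> (tag p == k)%:R)) mulrC.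
Qed.

Lemma antipode_cut_part n (x : V) : n != 0%N ->
  (forall s, s \in msupp x -> tag s = n) ->
  antipode x = - \sum_(k < n)
    fq_mulT (tensor_map (@antipode K) idfun (cut_part k x) : V2) :> V.
Proof.
move=> n0 xn.
transitivity (- \sum_(k < n) \sum_(s <- msupp x)
   x@_s *: (fq_mul (left_antipode K (seg s 0 k)) (F_ K (seg s k (tag s - k))) : V)).
  rewrite exchange_big -sumrN /antipode /lin_ext; apply: eq_big_seq => s /xn sn.
  rewrite left_antipodeE ?sn // -scaler_sumr scalerN; congr (- (_ *: _)).
congr (- _); apply: eq_bigr => k _.
rewrite /cut_part (linear_lin_ext (tensor_map (@antipode K) idfun)).
rewrite (linear_lin_ext (@fq_mulT K)) /lin_ext; apply: eq_bigr => s _.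
by rewrite /= /tensor_map lin_extU /= /antipode /F_ lin_extU.
Qed.

Lemma msupp_class_sum r s : s \in msupp (class_sum r) -> tag s = tag r.
Proof.
rewrite -mcoeff_neq0 class_sumE; case: s => n s.
have [e|ne] := eqVneq (tag r) n; first by move=> _; apply: esym.
by rewrite -[existT _ n s]/(DWord s) mcoeff_F_sum0 ?eqxx.
Qed.

(** By [antipode_cut_part] the antipode of x comes from tensors of class sums,
    with the antipode applied to first factors smaller than x only. *)
Lemma PT_antipode_homogeneous n (x : V) : step_invariant (fun s => x@_s) ->
  (forall s, s \in msupp x -> tag s = n) -> PT (antipode x : FQSym K).
Proof.
have [m] := ubnP n; elim: m n x => // m IH n x; rewrite ltnS => nm xi xn.
have [n0|n0] := eqVneq n 0%N.
  apply: span_sum => s /xn sn _; rewrite left_antipode0 ?sn //.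
  exact/spanZ/PT_one.
rewrite (antipode_cut_part n0 xn) -scaleN1r; apply: spanZ.
apply: span_sum => k _ _; have kn : (k <= n)%N := ltnW (ltn_ord k).
rewrite (bi_invariant_decomposition (z := cut_part k x)); first last.
- move=> p i s t st; rewrite !(mcoeff_cut_part _ _ kn xn) !mcoeff_comul.
  by congr (_ * _); apply: (convolution_invariant_r p xi st).
- move=> q i s t st; rewrite !(mcoeff_cut_part _ _ kn xn) !mcoeff_comul.
  by congr (_ * _); apply: (convolution_invariant_l q xi st).
rewrite (linear_sum (tensor_map (@antipode K) idfun)) (linear_sum (@fq_mulT K)).
apply: span_sum => r; rewrite -mcoeff_neq0; case: r => p q zr _.
rewrite !linearZ /=; apply: spanZ.
rewrite (tensor_mapE (@antipode K) idfun) -/(fq_mul _ _).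
apply: PT_mul; last exact: PT_class_sum.
have pk : tag p = k.
  apply/eqP; move: zr; rewrite (mcoeff_cut_part _ _ kn xn).
  by case: (tag p == k) => //; rewrite mul0r eqxx.
apply: (IH k) => [||s /msupp_class_sum ->] //.
- by apply: leq_trans (ltn_ord k) nm.
- exact/PT_invariant/PT_class_sum.
Qed.

Lemma PT_antipode (x : V) : PT (x : FQSym K) -> PT (antipode x : FQSym K).
Proof.
move=> [c [cP ->]]; rewrite (linear_sum (@antipode K)); apply: span_sum => p /cP.
move=> [n [T E]] _; rewrite linearZ /=; apply: spanZ; rewrite E.
apply: (PT_antipode_homogeneous (n := n)); first exact: P_step_invariant.
move=> [m s]; rewrite -mcoeff_neq0 /P_.
have [e|ne] := eqVneq n m; first by move=> _; apply: esym.
by rewrite -[existT _ m s]/(DWord s) mcoeff_F_sum0 ?eqxx.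
Qed.

End Main.

Theorem theorem60 (K : fieldType) : hopf_subalgebra (@PT K).
Proof.
split.
- exact: span0.
- by move=> c x y Px Py; apply: spanD => //; apply: spanZ.
- exact: PT_one.
- exact: PT_mul.
- exact: PT_comul.
- exists (@antipode K); split; first exact: antipodeP.
  exact: PT_antipode.
Qed.
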